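(* Let $f$ be a multi-valued function on represented spaces. Then the following are equivalent: (1) $f\leq_{\mathrm W}\mathsf{C}_{\mathbb{N}}$; (2) $f\leq_{\mathrm W}\lim_\Delta$; (3) $f$ is computable with finitely many mind changes.
   Context: Baire space is $\mathbb{N}^{\mathbb{N}}$, with its usual product topology, a fixed computable bijective pairing $\langle\cdot,\cdot\rangle$ and the canonical countable tupling $\langle p_0,p_1,p_2,\ldots\rangle$ on it. Computability of partial functions $F:\subseteq\mathbb{N}^{\mathbb{N}}\to\mathbb{N}^{\mathbb{N}}$ is meant via (type-2) Turing machines. A representation of a set $X$ is a surjective partial function $\delta:\subseteq\mathbb{N}^{\mathbb{N}}\to X$; $(X,\delta)$ is a represented space. $f:\subseteq X\rightrightarrows Y$ denotes a partial multi-valued function ($f(x)\neq\emptyset$ for $x\in\mathrm{dom}(f)$). A realizer of $f:\subseteq(X,\delta_X)\rightrightarrows(Y,\delta_Y)$, written $F\vdash f$, is a single-valued $F:\subseteq\mathbb{N}^{\mathbb{N}}\to\mathbb{N}^{\mathbb{N}}$ with $\delta_Y F(p)\in f\delta_X(p)$ for all $p\in\mathrm{dom}(f\delta_X)$. Weihrauch reducibility $f\leq_{\mathrm W}g$ means: there are computable $K,H:\subseteq\mathbb{N}^{\mathbb{N}}\to\mathbb{N}^{\mathbb{N}}$ such that $p\mapsto K\langle p,GH(p)\rangle$ is a realizer of $f$ for every $G\vdash g$. $\mathbb{N}$ has the representation $\delta_{\mathbb{N}}(p)=p(0)$. $\mathcal{A}_-(\mathbb{N})$ is the set of subsets of $\mathbb{N}$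 with the representation $\psi_-^{\mathbb{N}}(p)=\{n\in\mathbb{N}:n+1\notin\mathrm{range}(p)\}$ (enumeration of the complement). Closed choice on $\mathbb{N}$ is $\mathsf{C}_{\mathbb{N}}:\subseteq\mathcal{A}_-(\mathbb{N})\rightrightarrows\mathbb{N},\ A\mapsto A$ with domain the non-empty sets (any element of $A$ is an admissible output). The discrete limit is $\lim_\Delta:\subseteq\mathbb{N}^{\mathbb{N}}\to\mathbb{N}^{\mathbb{N}},\ \langle p_0,p_1,\ldots\rangle\mapsto\lim_{i\to\infty}p_i$, the limit taken with respect to the discrete topology on $\mathbb{N}^{\mathbb{N}}$; i.e. its domain consists of the eventually constant sequences $(p_i)_i$. Here $\mathbb{N}^{\mathbb{N}}$ is represented by the identity. $f:\subseteq(X,\delta_X)\rightrightarrows(Y,\delta_Y)$ is computable with finitely many mind changes if there is a Turing machine (working on infinite sequences) that may at any stage erase its whole output tape and start writing anew, such that on each input $p\in\mathrm{dom}(f\delta_X)$ it does so only finitely many times and the infinite sequence $q$ that it finally writes satisfies $\delta_Y(q)\in f\delta_X(p)$. *)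

(* Defs.v *)
From mathcomp Require Import all_boot.
From mathcomp Require Import boolp classical_sets.
From Stdlib Require Cantor.

Set Implicit Arguments.
Unset Strict Implicit.
Unset Printing Implicit Defensive.

Local Open Scope classical_set_scope.

(* Baire space.  Partial functions are [option]-valued; in the presence of
   the classical axioms of [boolp] this covers all partial functions, as no
   decidability of the domain is implied. *)

Definition baire : Type := nat -> nat.

Definition bpair (p q : baire) : baire :=
  fun n => if odd n then q n./2 else p n./2.

(* < p_0, p_1, ... > (< i, j >) = p_i (j), where
   < i, j > = j + (i + j) * (i + j + 1) / 2 is Cantor's pairing. *)
Definition btuple (ps : nat -> baire) : baire :=
  fun n => let (i, j) := Cantor.of_nat n in ps i j.

(* Points of Baire space are written on tapes over the finite alphabet bool,
   as the infinite word 1^{p 0} 0 1^{p 1} 0 1^{p 2} 0 ... (1 is [true]). *)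

Definition unary_block (n : nat) : seq bool := rcons (nseq n true) false.

Definition unary_prefix (p : baire) (n : nat) : seq bool :=
  flatten [seq unary_block (p i) | i <- iota 0 n].

(* The default value of [nth] is irrelevant: every block is nonempty, so that
   [unary_prefix p m.+1] has more than m letters. *)
Definition unary (p : baire) : nat -> bool :=
  fun m => nth false (unary_prefix p m.+1) m.

(* Type-2 Turing machines: finitely many states, a one-way read-only input
   tape carrying an infinite word, finitely many two-way infinite work tapes
   over a finite alphabet, and a one-way write-only output tape, which the
   machine may erase as a whole.  There is no halting state: a machine that
   stops is one that loops without touching its output, and neither produces
   an infinite output. *)

Inductive move : Type := MoveLeft | MoveNone | MoveRight.

Inductive output_action : Type := OutNone | OutWrite of bool | OutErase.

Record action (Q S : Type) (k : nat) : Type := Action {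
  act_state : Q;
  act_advance : bool;  (* whether the input head moves on by one cell *)
  act_work : 'I_k -> S * move;
  act_output : output_action
}.

Record machine : Type := Machine {
  state : finType;
  start : state;
  symbol : finType;
  blank : symbol;
  ntapes : nat;
  trans : state -> bool -> {ffun 'I_ntapes -> symbol} ->
          action state symbol ntapes
}.

(* [tape_left] is listed from the head outwards, as is [tape_right]; all cells
   beyond the two lists are blank. *)
Record tape (S : Type) : Type := Tape {
  tape_left : seq S;
  tape_head : S;
  tape_right : seq S
}.

Definition tape_update (S : Type) (b : S) (sm : S * move) (t : tape S) :
    tape S :=
  let: (s, m) := sm in
  match m with
  | MoveLeft =>
      Tape (behead (tape_left t)) (head b (tape_left t)) (s :: tape_right t)
  | MoveNone => Tape (tape_left t) s (tape_right t)
  | MoveRight =>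
      Tape (s :: tape_left t) (head b (tape_right t)) (behead (tape_right t))
  end.

Record config (M : machine) : Type := Config {
  cfg_state : state M;
  cfg_input : nat;  (* position of the input head *)
  cfg_work : 'I_(ntapes M) -> tape (symbol M);
  cfg_output : seq bool
}.

Definition output_update (a : output_action) (w : seq bool) : seq bool :=
  match a with
  | OutNone => w
  | OutWrite b => rcons w b
  | OutErase => [::]
  end.

Definition init (M : machine) : config M :=
  Config (start M) 0 (fun _ => Tape [::] (blank M) [::]) [::].

Definition cfg_action (M : machine) (w : nat -> bool) (c : config M) :
    action (state M) (symbol M) (ntapes M) :=
  trans (cfg_state c) (w (cfg_input c))
        [ffun i => tape_head (cfg_work c i)].

Definition step (M : machine) (w : nat -> bool) (c : config M) : config M :=
  let a := cfg_action w c in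
  Config (act_state a)
         (cfg_input c + act_advance a)
         (fun i => tape_update (blank M) (act_work a i) (cfg_work c i))
         (output_update (act_output a) (cfg_output c)).

Definition run (M : machine) (p : baire) (t : nat) : config M :=
  iter t (step (unary p)) (init M).

Definition erases_at (M : machine) (p : baire) (t : nat) : Prop :=
  act_output (cfg_action (unary p) (run M p t)) = OutErase.

Definition never_erases (M : machine) : Prop :=
  forall (s : state M) (b : bool) (v : {ffun 'I_(ntapes M) -> symbol M}),
    act_output (trans s b v) <> OutErase.

(* M performs only finitely many erasures on input p, and the infinite word
   that it writes after the last one is the one for q. *)
Definition finally_writes (M : machine) (p q : baire) : Prop :=
  exists t0 : nat,
    (forall t, t0 <= t -> ~ erases_at M p t) /\
    (forall n, exists2 t, t0 <= t &
       prefix (unary_prefix q n) (cfg_output (run M p t))).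

(* As usual, the machine is only required to behave correctly on the domain
   of F. *)
Definition computable (F : baire -> option baire) : Prop :=
  exists2 M : machine, never_erases M &
    forall p q, F p = Some q ->
      forall n, exists t, prefix (unary_prefix q n) (cfg_output (run M p t)).

Record represented : Type := Represented {
  carrier :> Type;
  rep : baire -> option carrier;
  rep_surj : forall x, exists p, rep p = Some x
}.

(* Partial multi-valued functions; the domain consists of the points with
   nonempty image. *)
Definition mvfun (X Y : Type) : Type := X -> set Y.

Definition dom (X Y : Type) (f : mvfun X Y) : set X :=
  [set x | exists y, f x y].

Definition realizes (X Y : represented) (F : baire -> option baire)
    (f : mvfun X Y) : Prop :=
  forall p x, rep X p = Some x -> dom f x ->
    exists q y, [/\ F p = Some q, rep Y q = Some y & f x y].

Definition weihrauch_le (X Y Z W : represented)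
    (f : mvfun X Y) (g : mvfun Z W) : Prop :=
  exists K H : baire -> option baire,
    [/\ computable K, computable H &
        forall G : baire -> option baire, realizes G g ->
          realizes (fun p => obind (fun r => K (bpair p r)) (obind G (H p))) f].

Definition mind_change_computable (X Y : represented) (f : mvfun X Y) : Prop :=
  exists M : machine,
    forall p x, rep X p = Some x -> dom f x ->
      exists q y, [/\ finally_writes M p q, rep Y q = Some y & f x y].

Definition rep_baire (p : baire) : option baire := Some p.

Lemma rep_baire_surj (x : baire) : exists p, rep_baire p = Some x.
Proof. by exists x. Qed.

Definition baire_space : represented := Represented rep_baire_surj.

Definition rep_nat (p : baire) : option nat := Some (p 0).

Lemma rep_nat_surj (n : nat) : exists p, rep_nat p = Some n.
Proof. by exists (fun _ => n). Qed.

Definition nat_space : represented := Represented rep_nat_surj.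

Definition rep_closed (p : baire) : option (set nat) :=
  Some [set n | ~ exists k, p k = n.+1].

Lemma rep_closed_surj (A : set nat) : exists p, rep_closed p = Some A.
Proof.
exists (fun k => if `[< A k >] then 0 else k.+1).
congr Some; apply/seteqP; split => n /=.
- by move=> nAn; apply: contrapT => An; apply: nAn; exists n; rewrite asboolF.
- by move=> An [k]; case: asboolP => // nAk [kn]; apply: nAk; rewrite kn.
Qed.

Definition closed_space : represented := Represented rep_closed_surj.

Definition choice_nat : mvfun closed_space nat_space := fun A => A.

Definition lim_discrete : mvfun baire_space baire_space :=
  fun p => [set q | exists ps : nat -> baire,
    p = btuple ps /\ exists n0, forall i, n0 <= i -> ps i = q].

(* Main.v *)
Require Import Defs.
From HB Require Import structures.
From mathcomp Require Import all_boot zify.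
From mathcomp Require Import boolp classical_sets.
From Stdlib Require Cantor.

Set Implicit Arguments.
Unset Strict Implicit.
Unset Printing Implicit Defensive.

(** The equivalence is a cycle of three reductions, each of which builds
    machines out of the ones it is given.

    From closed choice to the discrete limit ([choice_to_lim]).  If h enumerates
    the complement of a nonempty set A, then the least number that h has not
    enumerated before stage s is, for large s, the least element of A.  A
    sequence of numbers that is eventually equal to n, cut into rows by Cantor's
    pairing, has rows that are eventually the constant point n; its discrete
    limit therefore names an element of A.  So it suffices to follow H by the
    machine [least], and K is kept.

    From the discrete limit to mind changes ([lim_to_mind_change]).  The machine
    [limit] reads a sequence of points along the diagonals of Cantor's pairing
    and writes row c of it, for a guess c.  All later rows are compared with the
    part of row c that is already written.  At a mismatch in diagonal d the
    output is erased and the guess becomes d + 1.  There are no mismatches once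
    c is beyond the point where the rows are constant, and a guess that is never
    refuted is right, because each entry of row c is compared with the
    corresponding entry of arbitrarily late rows.  This machine sits between the
    machines of H and K.

    From mind changes to closed choice ([mind_change_to_choice]).  Given M with
    finitely many mind changes, call candidate the instant that follows the last
    erasure seen so far.  The machine [refuter] enumerates at each step exactly
    one number: the instant after the present one if M does not erase, and the
    old candidate if M does.  What is never enumerated is the final candidate
    ([not_refuted], [last_candidate_not_refuted]), at which the output of M is
    empty and after which M erases no more.  Knowing it, K runs M and ignores
    the output until then ([split_machine], [delay]).

    Transition tables enter only through stack machines.  These have finitely
    many stacks, can act on all of them at once, and can move a whole
    stack onto others in one step; [compile] turns each of them into a machine of
    the kind required.  A simulated machine keeps the two sides of each tape on
    two stacks ([simulates_step]).  The composition of two machines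
    ([comp_swrites]) runs the first on the input and the second on what the first
    writes, or on the pair of the input and what the first writes, and restarts
    the second whenever the first erases.

    Throughout, points of Baire space are replaced by the infinite words that
    encode them, and [writes M w u] says that M, on the word w, makes finitely
    many erasures and finally writes u; for a machine that never erases this is
    ordinary computation. *)

(** * Words on tapes and machines with counted erasures *)

Definition word := nat -> bool.

Definition erasing (a : output_action) : bool :=
  if a is OutErase then true else false.

(** A configuration together with the number of erasures made so far: finitely
    many mind changes then means that this number is bounded. *)
Definition xstep (M : machine) (w : word) (x : config M * nat) : config M * nat :=
  (step w x.1, x.2 + erasing (act_output (cfg_action w x.1))).

Definition xrun (M : machine) (w : word) (t : nat) : config M * nat :=
  iter t (xstep w) (init M, 0).

(** The number of erasures never decreases and a prefix of length k takes at
    least k steps to write, so that a number of erasures that recurs with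
    arbitrarily long prefixes is the final one. *)
Definition writes (M : machine) (w u : word) : Prop :=
  exists e, forall k, exists t,
    (xrun M w t).2 = e /\ prefix (mkseq u k) (cfg_output (xrun M w t).1).

Lemma xrunS M w t : xrun M w t.+1 = xstep w (xrun M w t).
Proof. by rewrite /xrun iterS. Qed.

Lemma run_xrun M p t : run M p t = (xrun M (unary p) t).1.
Proof. by elim: t => // t IH; rewrite xrunS /= -IH. Qed.

Lemma erases_atP M p t :
  erases_at M p t <->
  erasing (act_output (cfg_action (unary p) (xrun M (unary p) t).1)).
Proof.
by rewrite /erases_at run_xrun; case: (act_output _) => [|b|]; split.
Qed.

Lemma xrun_count_le M w s t : s <= t -> (xrun M w s).2 <= (xrun M w t).2.
Proof.
move/subnK <-; elim: (t - s) => // n IH.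
by rewrite addSn xrunS /=; apply: leq_trans IH _; exact: leq_addr.
Qed.

Lemma size_output_le M w t : size (cfg_output (xrun M w t).1) <= t.
Proof.
elim: t => // t IH; rewrite xrunS /= ; case: act_output => //=.
- exact: ltnW.
- by move=> b; rewrite size_rcons.
Qed.

Lemma output_prefix M w s t : s <= t -> (xrun M w t).2 = (xrun M w s).2 ->
  prefix (cfg_output (xrun M w s).1) (cfg_output (xrun M w t).1).
Proof.
move=> st; move: (subnK st) => <-; elim: (t - s) => [_|n IH].
  exact: prefix_refl.
rewrite addSn => E.
have le1 := @xrun_count_le M w s (n + s) (leq_addl _ _).
move: E; rewrite xrunS /= => E.
have {}IH : prefix (cfg_output (xrun M w s).1) (cfg_output (xrun M w (n + s)).1).
  by apply: IH; apply/eqP; rewrite eqn_leq le1 andbT -E leq_addr.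
apply: (prefix_trans IH).
move: E; case: (act_output _) => [|b|] /= E; first exact: prefix_refl.
- exact: prefix_rcons.
- by lia.
Qed.

Lemma prefix_mkseq (u : word) s k : prefix s (mkseq u k) -> s = mkseq u (size s).
Proof.
move=> /prefixP [s' E]; apply: (@eq_from_nth _ false); first by rewrite size_mkseq.
move=> i ilt; rewrite nth_mkseq //.
have : nth false (mkseq u k) i = nth false (s ++ s') i by rewrite E.
rewrite nth_cat ilt nth_mkseq => [-> //|].
by move: (congr1 size E); rewrite size_cat size_mkseq => ->; exact: ltn_addr.
Qed.

Lemma mkseq_prefix (u : word) j k : j <= k -> prefix (mkseq u j) (mkseq u k).
Proof.
move=> jk; apply/prefixP; exists [seq u i | i <- iota j (k - j)].
by rewrite /mkseq -map_cat -iotaD subnKC.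
Qed.

(** From the last erasure on, every output is a prefix of the word written: it is
    extended by later outputs, among which there are prefixes of that word of
    any length. *)
Lemma writes_stable M w u : writes M w u -> exists t0,
  [/\ forall t, t0 <= t -> ~~ erasing (act_output (cfg_action w (xrun M w t).1)),
      forall t, t0 <= t -> cfg_output (xrun M w t).1
                           = mkseq u (size (cfg_output (xrun M w t).1)) &
      forall k, exists2 t, t0 <= t & k <= size (cfg_output (xrun M w t).1)].
Proof.
move=> [e H]; have [t0 [E0 _]] := H 0.
(* A prefix of length k needs k steps, so that such instants are arbitrarily late. *)
have big k : exists t, [/\ k <= t, (xrun M w t).2 = e &
    prefix (mkseq u k) (cfg_output (xrun M w t).1)].
  have [t [Et Pt]] := H k; exists t; split=> //.
  have := size_prefix Pt; rewrite size_mkseq => /leq_trans; apply.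
  exact: size_output_le.
have st t : t0 <= t -> (xrun M w t).2 = e.
  move=> le; have [t' [le' E' _]] := big t.
  have := @xrun_count_le M w _ _ le; have := @xrun_count_le M w _ _ le'; lia.
exists t0; split.
- move=> t le; have := st t.+1 (leqW le); rewrite xrunS /= (st _ le).
  by case: erasing => //; lia.
- move=> t le; have [t' [le' E' P']] := big (maxn t (size (cfg_output (xrun M w t).1))).
  have Q : prefix (cfg_output (xrun M w t).1) (cfg_output (xrun M w t').1).
    apply: output_prefix; first by lia.
    by rewrite E' st.
  apply: (@prefix_mkseq u _ (maxn t (size (cfg_output (xrun M w t).1)))).
  move: P' Q => /prefixP [s1 ->] /prefixP [s2 E2].
  set o := cfg_output _ in E2 *; set m := maxn _ _ in E2 *.
  have sz : size o <= size (mkseq u m) by rewrite size_mkseq; lia.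
  rewrite prefixE.
  have := congr1 (take (size o)) E2.
  by rewrite (takel_cat _ sz) (take_size_cat s2 erefl) => ->.
- move=> k; have [t [le E P]] := big (maxn k t0); exists t; first by lia.
  by have := size_prefix P; rewrite size_mkseq; apply: leq_trans; exact: leq_maxl.
Qed.

Lemma unary_prefixS p n : unary_prefix p n.+1 = unary_prefix p n ++ unary_block (p n).
Proof. by rewrite /unary_prefix -addn1 iotaD map_cat flatten_cat /= cats0. Qed.

Lemma size_unary_prefix p n : n <= size (unary_prefix p n).
Proof.
elim: n => // n IH; rewrite unary_prefixS size_cat /unary_block size_rcons addnS ltnS.
exact: leq_trans IH (leq_addr _ _).
Qed.

Lemma unary_prefix_le p m n : m <= n -> prefix (unary_prefix p m) (unary_prefix p n).
Proof.
move/subnK <-; elim: (n - m) => [|k IH]; first exact: prefix_refl.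
by apply: (prefix_trans IH); rewrite addSn unary_prefixS; exact: prefix_prefix.
Qed.

Lemma nth_prefix (s t : seq bool) i : prefix s t -> i < size s ->
  nth false t i = nth false s i.
Proof. by move=> /prefixP [r ->] lt; rewrite nth_cat lt. Qed.

Lemma nth_unary_prefix p n i : i < size (unary_prefix p n) ->
  nth false (unary_prefix p n) i = unary p i.
Proof.
move=> lt; rewrite /unary; case: (leqP n i.+1) => le.
  by rewrite (nth_prefix (unary_prefix_le p le)).
rewrite (nth_prefix (unary_prefix_le p (ltnW le))) //.
exact: size_unary_prefix.
Qed.

Lemma unary_prefixE p n : unary_prefix p n = mkseq (unary p) (size (unary_prefix p n)).
Proof.
apply: (@eq_from_nth _ false) => [|i lt]; first by rewrite size_mkseq.
by rewrite nth_mkseq // nth_unary_prefix.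
Qed.

(** Random access to the letters of an encoded point, by block and offset; the
    offset p m designates the separator that ends block m. *)
Lemma unary_letter p m o : o <= p m ->
  unary p (size (unary_prefix p m) + o) = (o < p m).
Proof.
move=> le; rewrite -(@nth_unary_prefix p m.+1); last first.
  by rewrite unary_prefixS size_cat ltn_add2l size_rcons size_nseq ltnS.
rewrite unary_prefixS nth_cat ltnNge leq_addr /= addKn /unary_block nth_rcons size_nseq.
by rewrite nth_nseq; case: ltngtP le.
Qed.

Lemma writes_unary M w q :
  writes M w (unary q) <-> exists e, forall k, exists t,
    (xrun M w t).2 = e /\ prefix (unary_prefix q k) (cfg_output (xrun M w t).1).
Proof.
split=> - [e H]; exists e => k.
  have [t [E P]] := H (size (unary_prefix q k)).
  by exists t; split=> //; rewrite unary_prefixE.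
have [t [E P]] := H k; exists t; split=> //; apply: prefix_trans P.
by rewrite unary_prefixE; apply: mkseq_prefix; exact: size_unary_prefix.
Qed.

Lemma finally_writesP M p q :
  finally_writes M p q <-> writes M (unary p) (unary q).
Proof.
split.
  move=> [t0 [noer H]]; apply/writes_unary.
  exists (xrun M (unary p) t0).2 => k; have [t le P] := H k.
  exists t; rewrite -run_xrun; split=> //.
  move/subnK: le <-; elim: (t - t0) => // n IH; rewrite addSn xrunS /= IH.
  have /erases_atP/negP/negbTE -> := noer (n + t0) (leq_addl _ _).
  by rewrite addn0.
move=> W; have [t0 [noer out grow]] := writes_stable W.
exists t0; split=> [t le|n].
  by move/erases_atP; apply/negP; exact: noer.
have [t le sz] := grow (size (unary_prefix q n)); exists t => //.
by rewrite run_xrun (out _ le) unary_prefixE mkseq_prefix.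
Qed.

Lemma no_erasure_count M w t : never_erases M -> (xrun M w t).2 = 0.
Proof.
move=> nv; elim: t => // t IH; rewrite xrunS /= IH add0n /cfg_action.
by case E : (act_output _) => //; have := nv _ _ _ E.
Qed.

(** Computability and finitely many mind changes differ only in that the former
    forbids erasures. *)
Lemma computableP F : computable F <->
  exists2 M, never_erases M &
    forall p q, F p = Some q -> writes M (unary p) (unary q).
Proof.
split=> - [M nv H]; exists M => // p q Fp.
  apply/writes_unary; exists 0 => k; have [t P] := H _ _ Fp k.
  by exists t; rewrite no_erasure_count // -run_xrun.
move=> n; have /writes_unary [e W] := H _ _ Fp.
by have [t [_ P]] := W n; exists t; rewrite run_xrun.
Qed.

(** * Stack machines and their compilation *)

Variant stack_op (G : Type) : Type := Keep | Pop | Push of G | Clear.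
Arguments Keep {G}.
Arguments Pop {G}.
Arguments Clear {G}.

Definition apply_op (G : Type) (o : stack_op G) (s : seq G) : seq G :=
  match o with
  | Keep => s
  | Pop => behead s
  | Push a => a :: s
  | Clear => [::]
  end.

(** A value [Some (i, D, e)] empties stack i, letter by letter, onto all stacks of
    D, and writes a letter [true] for each letter moved if e holds.  With counters
    kept in unary, this one operation reverses, copies and prints. *)
Definition transfer (K : finType) : Type := option (K * {set K} * bool).

Definition transfer_stacks (K : finType) (G : Type) (d : transfer K)
    (s : K -> seq G) : K -> seq G :=
  if d is Some (i, D, _) then fun j =>
    if j == i then [::] else if j \in D then catrev (s i) (s j) else s j
  else s.

Definition transfer_output (K : finType) (G : Type) (d : transfer K)
    (s : K -> seq G) : seq bool :=
  if d is Some (i, _, true) then nseq (size (s i)) true else [::].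

Record saction (Q G : Type) (K : finType) : Type := SAction {
  sa_mem : Q;
  sa_advance : bool;
  sa_ops : K -> stack_op G;
  sa_output : output_action;
  sa_transfer : transfer K
}.

(** In one step a stack machine reads the current input letter and the tops of all
    stacks, acts on all stacks, then performs at most one transfer. *)
Record smachine : Type := SMachine {
  smem : finType;
  sstart : smem;
  sindex : finType;
  sletter : finType;
  strans : smem -> bool -> (sindex -> option sletter) ->
           saction smem sletter sindex
}.

Record sconfig (S : smachine) : Type := SConfig {
  sc_mem : smem S;
  sc_input : nat;
  sc_stack : sindex S -> seq (sletter S);
  sc_output : seq bool;
  sc_erasures : nat
}.

Definition sinit (S : smachine) : sconfig S :=
  SConfig (sstart S) 0 (fun _ => [::]) [::] 0.

Definition sc_action (S : smachine) (w : word) (c : sconfig S) :=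
  strans (sc_mem c) (w (sc_input c)) (fun i => ohead (sc_stack c i)).

Definition sstep (S : smachine) (w : word) (c : sconfig S) : sconfig S :=
  let a := sc_action w c in
  let s := fun i => apply_op (sa_ops a i) (sc_stack c i) in
  SConfig (sa_mem a) (sc_input c + sa_advance a)
    (transfer_stacks (sa_transfer a) s)
    (output_update (sa_output a) (sc_output c) ++
       transfer_output (sa_transfer a) s)
    (sc_erasures c + erasing (sa_output a)).

Definition srun (S : smachine) (w : word) (n : nat) : sconfig S :=
  iter n (sstep w) (sinit S).
Arguments srun : simpl never.

Definition swrites (S : smachine) (w u : word) : Prop :=
  exists e, forall k, exists n,
    sc_erasures (srun S w n) = e /\ prefix (mkseq u k) (sc_output (srun S w n)).

Definition snever_erases (S : smachine) : Prop :=
  forall q b v, sa_output (@strans S q b v) <> OutErase.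

Section Compile.
Variable S : smachine.
Local Notation Q := (smem S).
Local Notation K := (sindex S).
Local Notation G := (sletter S).

(** Next to the memory of the stack machine, a state holds the letters that are
    still to be written on cells to which the heads have just moved, and the
    transfer that is still to be performed. *)
Definition cstate : finType :=
  (Q * option {ffun K -> option G} * option (K * {set K} * bool))%type.

Definition ctrans (q : cstate) (b : bool) (v : {ffun 'I_#|K| -> option G}) :
    action cstate (option G) #|K| :=
  let: (m, pending, d) := q in
  let top := fun i => v (enum_rank i) in
  match pending with
  | Some u =>
      Action ((m, None, d) : cstate) false
        (fun t => (if u (enum_val t) is Some x then Some x else v t, MoveNone))
        OutNone
  | None =>
    match d with
    | Some (i, D, e) =>
        if top i is Some x then
          Action ((m, Some [ffun j => if (j \in D) && (j != i) then Some x
                                      else None], d) : cstate) false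
            (fun t => let j := enum_val t in
               if j == i then (None, MoveLeft) else
               (v t, if j \in D then MoveRight else MoveNone))
            (if e then OutWrite true else OutNone)
        else Action ((m, None, None) : cstate) false
               (fun t => (v t, MoveNone)) OutNone
    | None =>
        let a := strans m b top in
        Action ((sa_mem a, Some [ffun j => if sa_ops a j is Push x then Some x
                                           else None], sa_transfer a) : cstate)
          (sa_advance a)
          (fun t => match sa_ops a (enum_val t) with
             | Keep => (v t, MoveNone)
             | Pop => if v t is None then (None, MoveNone) else (None, MoveLeft)
             | Push _ | Clear => (v t, MoveRight)
             end)
          (sa_output a)
    end
  end.

Definition compile : machine :=
  @Machine cstate (sstart S, None, None) (option G : finType) None #|K| ctrans.

(** The stack is the word of nonblank cells from the head leftwards, up to the
    first blank.  Below that blank there may be garbage, so a stack is cleared by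
    one move to a fresh cell on the right, where all cells are blank.  The [rcons]
    accounts for the cells beyond the list, which are blank too. *)
Definition holds (s : seq G) (t : tape (option G)) : Prop :=
  (exists g, rcons (tape_head t :: tape_left t) None = map Some s ++ None :: g)
  /\ all (fun x => x == None) (tape_right t).

Lemma holds_head s t : holds s t -> tape_head t = ohead s.
Proof. by case: s => [|x s] [[g [-> _]]]. Qed.

Lemma holds_write s t : holds s t ->
  holds s (tape_update None (tape_head t, MoveNone) t).
Proof. by []. Qed.

Lemma holds_pop x s t : holds (x :: s) t ->
  holds s (tape_update None (None, MoveLeft) t).
Proof.
case: t => [l h r] [[g /=] [_ E] Hr]; split => //=.
case: l E => [|y l] /= E; last by exists g.
by case: s E => [|? s] //= _; exists [:: None].
Qed.

Lemma all_blank_behead (r : seq (option G)) :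
  all (fun x => x == None) r ->
  head None r = None /\ all (fun x => x == None) (behead r).
Proof. by case: r => //= x r /andP [/eqP -> ->]. Qed.

Lemma holds_clear s t : holds s t ->
  holds [::] (tape_update None (tape_head t, MoveRight) t).
Proof.
case: t => [l h r] [[g E]] /= /all_blank_behead [Er Hr]; split => //=.
by rewrite Er; eexists; reflexivity.
Qed.

Lemma holds_push x s t : holds s t ->
  holds (x :: s) (tape_update None (Some x, MoveNone)
                   (tape_update None (tape_head t, MoveRight) t)).
Proof.
case: t => [l h r] [[g /= E]] /= /all_blank_behead [Er Hr]; split => //=.
by exists g; rewrite -E.
Qed.

(** A push takes two steps, a move to a fresh cell and the writing of the letter;
    in between, the tape holds the stack up to that writing. *)
Definition pending_holds (o : option G) (s : seq G) (t : tape (option G)) :=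
  if o is Some x then
    holds s (tape_update None (Some x, MoveNone) t)
  else holds s t.

Definition related (q : cstate) (pos : nat) (stk : K -> seq G) (out : seq bool)
    (ers : nat) (x : config compile * nat) : Prop :=
  [/\ cfg_state x.1 = q, cfg_input x.1 = pos,
      forall t, pending_holds (if q.1.2 is Some u then u (enum_val t) else None)
                   (stk (enum_val t)) (cfg_work x.1 t),
      cfg_output x.1 = out & x.2 = ers].

Lemma heads_related q pos stk out ers x : q.1.2 = None ->
  related q pos stk out ers x ->
  (fun i => [ffun t => tape_head (cfg_work x.1 t)] (enum_rank i))
  = (fun i => ohead (stk i)).
Proof.
move=> Eq [_ _ H _ _]; apply/funext => i; rewrite ffunE.
by have := H (enum_rank i); rewrite Eq enum_rankK /= => /holds_head.
Qed.

Lemma push_step w m u d pos stk out ers x :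
  related (m, Some u, d) pos stk out ers x ->
  related (m, None, d) pos stk out ers (xstep w x).
Proof.
move=> [E1 E2 H E4 E5].
have Ea : cfg_action w x.1 = ctrans (m, Some u, d) (w (cfg_input x.1))
      [ffun t => tape_head (cfg_work x.1 t)] by rewrite /cfg_action E1.
rewrite /related /xstep /step Ea /= addn0 E2 E4 E5; split=> //; last by rewrite addn0.
by move=> t; move: (H t); rewrite ffunE /=; case: (u _).
Qed.

Lemma act_step w m pos stk out ers x :
  related (m, None, None) pos stk out ers x ->
  let a := strans m (w pos) (fun i => ohead (stk i)) in
  related (sa_mem a, None, sa_transfer a) (pos + sa_advance a)
    (fun i => apply_op (sa_ops a i) (stk i))
    (output_update (sa_output a) out) (ers + erasing (sa_output a))
    (iter 2 (xstep w) x).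
Proof.
move=> R a; have Et := @heads_related (_, None, _) _ _ _ _ _ erefl R.
move: (R) => [E1 E2 H E4 E5].
apply: push_step.
have Ea : cfg_action w x.1 = ctrans (m, None, None) (w (cfg_input x.1))
      [ffun t => tape_head (cfg_work x.1 t)] by rewrite /cfg_action E1.
rewrite /related /xstep /step Ea /= Et E2 E4 E5 -/a; split=> // t.
rewrite !ffunE; have Hs := H t; rewrite /= in Hs.
case: (sa_ops a (enum_val t)) => [||y|] /=.
- exact: holds_write.
- rewrite (holds_head Hs); case E: (stk _) Hs => [|y s] Hs /=.
    by have := holds_write Hs; rewrite (holds_head Hs).
  exact: holds_pop Hs.
- exact: holds_push.
- exact: holds_clear Hs.
Qed.

(** Each round of the loop pops one letter and pushes it on the targets, in two
    steps, and leaves a transfer of the same kind with one letter less. *)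
Lemma transfer_run w m (i : K) D e pos s : forall stk out ers x, stk i = s ->
  related (m, None, Some (i, D, e)) pos stk out ers x ->
  exists t, related (m, None, None) pos (transfer_stacks (Some (i, D, e)) stk)
    (out ++ transfer_output (Some (i, D, e)) stk) ers (iter t (xstep w) x).
Proof.
elim: s => [|y s IH] stk out ers x Es R;
  have Et := @heads_related (_, None, _) _ _ _ _ _ erefl R;
  move: (R) => [E1 E2 H E4 E5];
  have Ea : cfg_action w x.1 = ctrans (m, None, Some (i, D, e))
     (w (cfg_input x.1)) [ffun t => tape_head (cfg_work x.1 t)]
     by rewrite /cfg_action E1.
  have Eti := congr1 (fun f => f i) Et; rewrite /= Es /= in Eti.
  exists 1; rewrite [iter _ _ _]/= /related /xstep /step Ea /= Eti /=.
  rewrite addn0 E4 E5 Es /=.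
  split=> //; last 2 first.
  - by case: (e); rewrite ?cats0.
  - by rewrite addn0.
  move=> t; rewrite ffunE /=; have /= Hs := H t.
  case: eqP => [E|_]; first by rewrite -Es -E; exact: holds_write.
  by case: ifP => _; exact: holds_write.
have Eti := congr1 (fun f => f i) Et; rewrite /= Es /= in Eti.
pose stk' j := if j == i then s else if j \in D then y :: stk j else stk j.
have R' : related (m, None, Some (i, D, e)) pos stk'
    (out ++ nseq e true) ers (iter 2 (xstep w) x).
  apply: push_step.
  rewrite /related /xstep /step Ea /= Eti /= addn0 E2 E4 E5.
  split=> //; last 2 first.
  - by case: (e); rewrite /= ?cats0 ?cats1.
  - by case: (e); rewrite /= addn0.
  move=> t; rewrite !ffunE /= /stk'; have /= Hs := H t.
  case: eqP => [E|_] /=.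
    rewrite andbF /=.
    by move: Hs; rewrite E Es; exact: holds_pop.
  rewrite andbT; case: ifP => _; last exact: holds_write.
  exact: holds_push.
have Es' : stk' i = s by rewrite /stk' eqxx.
have [t Rt] := IH stk' _ _ _ Es' R'; exists (t + 2); rewrite iterD.
have -> : transfer_stacks (Some (i, D, e)) stk =
          transfer_stacks (Some (i, D, e)) stk'.
  apply/funext => j; rewrite /= Es' Es /stk'.
  by case: eqP => // _; case: ifP.
have -> : transfer_output (Some (i, D, e)) stk =
          nseq e true ++ transfer_output (Some (i, D, e)) stk'.
  by rewrite /= Es' Es; case: (e).
by rewrite catA.
Qed.

Lemma compile_step w c x :
  related (sc_mem c, None, None) (sc_input c) (sc_stack c) (sc_output c)
    (sc_erasures c) x ->
  exists t, let c' := sstep w c in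
    related (sc_mem c', None, None) (sc_input c') (sc_stack c') (sc_output c')
      (sc_erasures c') (iter t (xstep w) x).
Proof.
move=> /(act_step w) /=; rewrite -/(sc_action w c) /sstep /=.
case: (sa_transfer _) => [[[i D] e]|] R.
  have [t Rt] := transfer_run w erefl R.
  by exists (t + 2); rewrite iterD.
by exists 2; rewrite /= cats0.
Qed.

Lemma compile_run w n : exists t,
  cfg_output (xrun compile w t).1 = sc_output (srun S w n) /\
  (xrun compile w t).2 = sc_erasures (srun S w n).
Proof.
suff [t [_ _ _ H1 H2]] : exists t, let c := srun S w n in
    related (sc_mem c, None, None) (sc_input c) (sc_stack c) (sc_output c)
      (sc_erasures c) (xrun compile w t) by exists t.
elim: n => [|n [t R]].
  by exists 0; split=> // t; split=> //; exists [:: None].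
have [t' R'] := compile_step w R; exists (t' + t).
by rewrite /xrun iterD.
Qed.

(** Outputs and numbers of erasures of the stack machine all occur in the run of
    the compiled machine, which is all that the notion of writing looks at. *)
Theorem compile_writes w u : swrites S w u -> writes compile w u.
Proof.
move=> [e H]; exists e => k; have [n [<- P]] := H k.
by have [t [Eo Ee]] := compile_run w n; exists t; rewrite Eo.
Qed.

Theorem compile_never_erases : snever_erases S -> never_erases compile.
Proof.
move=> nv [[m u] d] b v /=; case: u => [u|] //.
case: d => [[[i D] e]|]; last exact: nv.
by case: (v _) => [x|] //; case: e.
Qed.
End Compile.

(** * Simulating a machine inside a stack machine *)

(** A common supply of names, for control states and for the stacks that do not
    belong to a simulated machine. *)
Variant label : Set := L0 | L1 | L2 | L3 | L4 | L5 | L6.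

Definition label_code (l : label) : nat :=
  match l with L0 => 0 | L1 => 1 | L2 => 2 | L3 => 3 | L4 => 4 | L5 => 5 | L6 => 6 end.

Definition label_decode (n : nat) : option label :=
  nth None (map Some [:: L0; L1; L2; L3; L4; L5; L6]) n.

Lemma label_codeK : pcancel label_code label_decode.
Proof. by case. Qed.

HB.instance Definition _ := Equality.copy label (pcan_type label_codeK).
HB.instance Definition _ := Choice.copy label (pcan_type label_codeK).
HB.instance Definition _ := Countable.copy label (pcan_type label_codeK).
Lemma label_enumP : Finite.axiom [:: L0; L1; L2; L3; L4; L5; L6].
Proof. by case. Qed.
HB.instance Definition _ := isFinite.Build label label_enumP.

Lemma labelE (x y : label) : (x == y) = (label_code x == label_code y).
Proof. by []. Qed.

Lemma inrE (A B : eqType) (x y : B) : ((inr x : (A + B)%type) == inr y) = (x == y).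
Proof. by []. Qed.

Lemma inlrE (A B : eqType) (x : A) (y : B) :
  ((inl x : (A + B)%type) == inr y) = false.
Proof. by []. Qed.

(** Decides whether a named stack is a given stack or among given stacks. *)
Definition indexE := (inE, inrE, inlrE, labelE).

Lemma input_le M w t : cfg_input (xrun M w t).1 <= t.
Proof.
elim: t => // t IH; rewrite xrunS /=; case: act_advance; lia.
Qed.

(** The finite part of a simulated configuration, its state and the letters under
    its heads, is kept in memory.  The tape on the left of head i is the stack
    (i, true), and the tape on its right is the stack (i, false).  The injection
    inj embeds the symbols in a larger stack alphabet. *)
Section Simulation.
Variables (M : machine) (G : Type).
Variables (inj : symbol M -> G) (prj : G -> symbol M).
Hypothesis injK : cancel inj prj.

Definition sim_mem : finType :=
  (state M * {ffun 'I_(ntapes M) -> symbol M})%type.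

Definition sim_init : sim_mem := (start M, [ffun=> blank M]).

Definition sim_action (m : sim_mem) (b : bool) := trans m.1 b m.2.

Definition sim_ops (a : action (state M) (symbol M) (ntapes M))
    (j : 'I_(ntapes M) * bool) : stack_op G :=
  let (s, mv) := act_work a j.1 in
  match mv, j.2 with
  | MoveLeft, true | MoveRight, false => Pop
  | MoveLeft, false | MoveRight, true => Push (inj s)
  | MoveNone, _ => Keep
  end.

Definition sim_next (a : action (state M) (symbol M) (ntapes M))
    (top : 'I_(ntapes M) * bool -> option G) : sim_mem :=
  (act_state a,
   [ffun i => let (s, mv) := act_work a i in
     match mv with
     | MoveLeft => odflt (blank M) (omap prj (top (i, true)))
     | MoveNone => s
     | MoveRight => odflt (blank M) (omap prj (top (i, false)))
     end]).

Definition simulates (m : sim_mem) (stk : 'I_(ntapes M) * bool -> seq G)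
    (c : config M) : Prop :=
  m = (cfg_state c, [ffun i => tape_head (cfg_work c i)]) /\
  forall i, stk (i, true) = map inj (tape_left (cfg_work c i)) /\
            stk (i, false) = map inj (tape_right (cfg_work c i)).

Lemma simulates_init stk : (forall j, stk j = [::]) ->
  simulates sim_init stk (init M).
Proof. by move=> H; split=> [|i]; rewrite ?H //. Qed.

Lemma simulates_ext m stk stk' c : simulates m stk c -> stk =1 stk' ->
  simulates m stk' c.
Proof. by move=> S /funext <-. Qed.

Lemma sim_actionE m stk c w : simulates m stk c ->
  sim_action m (w (cfg_input c)) = cfg_action w c.
Proof. by case=> ->. Qed.

(** A move pushes the written symbol on one side and pops the new head symbol from
    the other; popping an empty stack yields a blank and leaves it empty, exactly
    as for the lists of a tape. *)
Lemma simulates_step m stk c w : simulates m stk c ->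
  let a := cfg_action w c in
  simulates (sim_next a (fun j => ohead (stk j)))
    (fun j => apply_op (sim_ops a j) (stk j)) (step w c).
Proof.
move=> [Em H] a; split.
  congr (_, _); apply/ffunP => i; rewrite !ffunE /= -/a.
  have [-> ->] := H i; case: (act_work a i) => s [] //=.
    by case: tape_left => //= x l; rewrite injK.
  by case: tape_right => //= x l; rewrite injK.
move=> i; rewrite /sim_ops /= -/a; have [-> ->] := H i.
by case: (act_work a i) => s [] //=; rewrite behead_map.
Qed.

Definition sim_try (m : sim_mem) (o : option bool)
    (top : 'I_(ntapes M) * bool -> option G) :
    sim_mem * bool * ('I_(ntapes M) * bool -> stack_op G) * output_action :=
  if o is Some b then
    let a := sim_action m b in (sim_next a top, act_advance a, sim_ops a, act_output a)
  else (m, false, fun=> Keep, OutNone).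

Lemma sim_tryP m stk o (x : config M * nat) w : simulates m stk x.1 ->
  (forall b, o = Some b -> b = w (cfg_input x.1)) ->
  let: (m', adv, ops, out) := sim_try m o (fun j => ohead (stk j)) in
  let x' := if o then xstep w x else x in
  [/\ simulates m' (fun j => apply_op (ops j) (stk j)) x'.1,
      cfg_input x'.1 = cfg_input x.1 + adv,
      cfg_output x'.1 = output_update out (cfg_output x.1),
      x'.2 = x.2 + erasing out & adv -> o].
Proof.
move=> S H; case: o H => [b|] H /=; last first.
  rewrite !addn0; split=> //=.
rewrite (H b erefl).
rewrite (sim_actionE _ S); split=> //; exact: (simulates_step w S).
Qed.
End Simulation.

(** A reader of two words w and u at once is described by (s, i, j): i letters of w
    and j letters of u have been read, and s tells whether the next letter comes
    from u. *)
Definition mixbit (w u : word) (st : bool * nat * nat) : bool :=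
  let: (s, i, j) := st in if s then u j else w i.

(** With alt, the source changes after each letter [false], that is, at the end of
    each block; without alt, it never changes. *)
Definition switch (alt s b : bool) : bool := s (+) (alt && ~~ b).

Definition mixstate (alt : bool) (w u : word) (n : nat) : bool * nat * nat :=
  iter n (fun st => let: (s, i, j) := st in
            (switch alt s (mixbit w u st), i + ~~ s, j + s)) (~~ alt, 0, 0).

Definition mix (alt : bool) (w u : word) : word :=
  fun n => mixbit w u (mixstate alt w u n).

Lemma mixstateS alt w u n : mixstate alt w u n.+1 =
  let: (s, i, j) := mixstate alt w u n in
  (switch alt s (mix alt w u n), i + ~~ s, j + s).
Proof. by rewrite /mix; rewrite {1}/mixstate iterS. Qed.

Lemma mixstate_noalt w u n : mixstate false w u n = (true, 0, n).
Proof. by elim: n => // n IH; rewrite mixstateS IH /= addn1. Qed.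

Lemma mix_noalt w u : mix false w u = u.
Proof. by apply/funext => n; rewrite /mix mixstate_noalt. Qed.

(** The block and the offset in it reached after n letters. *)
Definition unary_pos (p : baire) (n : nat) : nat * nat :=
  iter n (fun x => if x.2 < p x.1 then (x.1, x.2.+1) else (x.1.+1, 0)) (0, 0).

Lemma unary_posS p n : unary_pos p n.+1 =
  if (unary_pos p n).2 < p (unary_pos p n).1
  then ((unary_pos p n).1, (unary_pos p n).2.+1)
  else ((unary_pos p n).1.+1, 0).
Proof. by []. Qed.

Lemma unary_posP p n : let: (m, o) := unary_pos p n in
  [/\ o <= p m, n = size (unary_prefix p m) + o & unary p n = (o < p m)].
Proof.
have H : (unary_pos p n).2 <= p (unary_pos p n).1 /\
   n = size (unary_prefix p (unary_pos p n).1) + (unary_pos p n).2.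
  elim: n => // n; rewrite unary_posS.
  case: (unary_pos p n) => m o /= [le E].
  case: ltnP => [lt|ge] /=; first by split=> //; lia.
  split=> //; rewrite unary_prefixS size_cat size_rcons size_nseq; lia.
case: (unary_pos p n) H => m o /= [le E]; split=> //.
by rewrite E unary_letter.
Qed.

(** The pair of two points is encoded by alternating the blocks of their
    encodings: block m of the pair is block m./2 of one of them. *)
Lemma mix_unary p q : mix true (unary p) (unary q) = unary (bpair p q).
Proof.
pose st n := let: (m, o) := unary_pos (bpair p q) n in
  let: (s, i, j) := mixstate true (unary p) (unary q) n in
  [/\ s = odd m, unary_pos p i = (uphalf m, if odd m then 0 else o) &
      unary_pos q j = (m./2, if odd m then o else 0)].
have bit n : st n -> mix true (unary p) (unary q) n = unary (bpair p q) n.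
  rewrite /st /mix; have := unary_posP (bpair p q) n.
  case: (unary_pos _ n) => m o [_ _ ->].
  case: (mixstate _ _ _ n) => [[s i] j] [-> Ei Ej] /=; rewrite /bpair.
  have := unary_posP p i; have := unary_posP q j; rewrite Ei Ej.
  rewrite uphalf_half; case: (odd m) => /= [[_ _ ->] _|_ [_ _ ->]] //.
suff H n : st n by apply/funext => n; apply: bit.
elim: n => // n IH; have := bit n IH; move: IH; rewrite /st mixstateS.
rewrite unary_posS; have := unary_posP (bpair p q) n.
case: (unary_pos _ n) => m o /= [le _ ->].
case: (mixstate _ _ _ n) => [[s i] j] [-> Ei Ej] ->.
case om : (odd m) Ei Ej le; rewrite /switch /bpair om /= => Ei Ej le;
  rewrite ?addn0 ?addn1 ?unary_posS ?Ei ?Ej /= uphalf_half om /=;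
  by case: ltnP => lt /=; rewrite ?om ?uphalf_half ?om //= ?add0n.
Qed.

(** * Composition *)

(** A queue is made of a front stack, popped from, and a back stack, pushed to; the
    back is reversed onto the front when the front has run empty.  The queue is
    settled when the top of the front is its first element. *)
Section Queue.
Variables (K : eqType) (G : Type).
Definition queue (s : K -> seq G) (f b : K) : seq G := s f ++ rev (s b).
Definition settled (s : K -> seq G) (f b : K) : Prop := s f = [::] -> s b = [::].

Lemma settled_top s f b : settled s f b -> ohead (s f) = ohead (queue s f b).
Proof. by rewrite /settled /queue; case: (s f) => //= ->. Qed.
End Queue.

Lemma drop_mkseq (w : word) a n : a < n ->
  drop a (mkseq w n) = w a :: drop a.+1 (mkseq w n).
Proof. by move=> lt; rewrite (drop_nth false) ?size_mkseq // nth_mkseq. Qed.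

Lemma mkseqS (w : word) n : mkseq w n.+1 = rcons (mkseq w n) (w n).
Proof. by rewrite /mkseq -addn1 iotaD map_cat cats1. Qed.

Lemma cat_mkseq_drop (w : word) i n : i <= n ->
  mkseq w i ++ drop i (mkseq w n) = mkseq w n.
Proof.
move=> le; rewrite -{2}(cat_take_drop i (mkseq w n)).
by rewrite /mkseq -map_take take_iota (minn_idPl le).
Qed.

Lemma queue_pop (T U : Type) (g : U -> T) f b a l (adv : bool) :
  f ++ rev b = map g (drop a l) -> (adv -> f <> [::]) ->
  apply_op (if adv then Pop else Keep) f ++ rev b = map g (drop (a + adv) l).
Proof.
case: adv => /=; last by rewrite addn0.
move=> E /(_ isT); rewrite addn1.
rewrite -[a.+1]add1n -drop_drop drop1 -behead_map -E.
by case: f {E}.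
Qed.

Lemma queue_push (T U : Type) (g : U -> T) f b a l x : a <= size l ->
  f ++ rev b = map g (drop a l) ->
  f ++ rev (g x :: b) = map g (drop a (rcons l x)).
Proof. by move=> le E; rewrite rev_cons -rcons_cat E drop_rcons // map_rcons. Qed.

Lemma leq_addb (b : bool) i n : i <= n -> (b -> i < n) -> i + b <= n.
Proof. by case: b => [_ /(_ isT)|]; rewrite ?addn1 ?addn0. Qed.

Definition refill (K : finType) (G : Type) (top : K -> option G) (f b : K) : transfer K :=
  if top f is Some _ then None else Some (b, [set f], false).

Lemma refillP (K : finType) (G : Type) (s : K -> seq G) (f b : K) : f != b ->
  let s' := transfer_stacks (refill (fun i => ohead (s i)) f b) s in
  [/\ queue s' f b = queue s f b, settled s' f b &
      forall i, i != f -> i != b -> s' i = s i].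
Proof.
move=> fb /=; rewrite /refill /queue /settled; case E : (s f) => [|x l] /=; last first.
  by split=> //; rewrite E.
rewrite eqxx (negbTE fb) inE eqxx E cats0 /= -/(rev _); split=> //.
by move=> i /negbTE nf /negbTE nb; rewrite nb inE nf.
Qed.

Lemma refill_output (K : finType) (G : Type) (top : K -> option G) f b (s : K -> seq G) :
  transfer_output (refill top f b) s = [::].
Proof. by rewrite /refill; case: (top f). Qed.

(** The composition of M1 and M2.  The input, of which one letter is read in each
    round, is queued twice: for M1, and, in case M2 runs on pairs (alt), for M2,
    whose reading position is independent of that of M1.  The output of M1 goes to
    a third queue.  As M2 may be restarted, the input letters that it has used are
    kept on the stack in2_read. *)
Section Composition.
Variables (alt : bool) (M1 M2 : machine).
Local Notation I1 := ('I_(ntapes M1) * bool)%type.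
Local Notation I2 := ('I_(ntapes M2) * bool)%type.

Definition comp_index : finType := ((I1 + I2) + label)%type.
Definition comp_letter : finType := ((symbol M1 + symbol M2) + bool)%type.
Definition comp_mem : finType := (label * bool * sim_mem M1 * sim_mem M2)%type.

Local Notation in1_front := (inr L0).
Local Notation in1_back := (inr L1).
Local Notation in2_front := (inr L2).
Local Notation in2_back := (inr L3).
Local Notation in2_read := (inr L4).
Local Notation mid_front := (inr L5).
Local Notation mid_back := (inr L6).
Local Notation working := L0.
Local Notation refill_in1 := L1.
Local Notation refill_in2 := L2.
Local Notation refill_mid := L3.

Definition bit (b : bool) : comp_letter := inr b.
Definition inj1 (s : symbol M1) : comp_letter := inl (inl s).
Definition inj2 (s : symbol M2) : comp_letter := inl (inr s).
Definition prj1 (g : comp_letter) := if g is inl (inl s) then s else blank M1.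
Definition prj2 (g : comp_letter) := if g is inl (inr s) then s else blank M2.
Definition prjb (g : comp_letter) := if g is inr b then b else false.

(** M1 and M2 both attempt one step.  If M1 erases, then M2 starts afresh: its
    tapes and the queue of outputs of M1 are cleared, and its input is rewound. *)
Definition comp_work (src : bool) (m1 : sim_mem M1) (m2 : sim_mem M2) (b : bool)
    (top : comp_index -> option comp_letter) :
    saction comp_mem comp_letter comp_index :=
  let: (m1', adv1, ops1, out1) :=
    sim_try inj1 prj1 m1 (omap prjb (top in1_front)) (fun j => top (inl (inl j))) in
  if erasing out1 then
    SAction ((refill_in1, ~~ alt, m1', sim_init M2) : comp_mem) true
      (fun i => match i with
       | inl (inl j) => ops1 j
       | inl (inr j) => Clear
       | in1_front => if adv1 then Pop else Keep
       | in1_back | in2_back => Push (bit b)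
       | mid_front | mid_back => Clear
       | _ => Keep
       end) OutErase (Some (in2_read, [set in2_front], false))
  else
    let c := omap prjb (top (if src then mid_front else in2_front)) in
    let: (m2', adv2, ops2, out2) := sim_try inj2 prj2 m2 c (fun j => top (inl (inr j))) in
    SAction ((refill_in1, if adv2 then switch alt src (odflt false c) else src, m1', m2') :
               comp_mem) true
      (fun i => match i with
       | inl (inl j) => ops1 j
       | inl (inr j) => ops2 j
       | in1_front => if adv1 then Pop else Keep
       | in1_back | in2_back => Push (bit b)
       | in2_front => if adv2 && ~~ src then Pop else Keep
       | in2_read => if adv2 && ~~ src then Push (bit (odflt false c)) else Keep
       | mid_front => if adv2 && src then Pop else Keep
       | mid_back => if out1 is OutWrite x then Push (bit x) else Keep
       end) out2 None.

Definition comp_trans (q : comp_mem) (b : bool)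
    (top : comp_index -> option comp_letter) :
    saction comp_mem comp_letter comp_index :=
  let: (ph, src, m1, m2) := q in
  let idle ph' d := SAction ((ph', src, m1, m2) : comp_mem) false (fun=> Keep) OutNone d in
  match ph with
  | working => comp_work src m1 m2 b top
  | refill_in1 => idle refill_in2 (refill top in1_front in1_back)
  | refill_in2 => idle refill_mid (refill top in2_front in2_back)
  | _ => idle working (refill top mid_front mid_back)
  end.

Definition composite : smachine :=
  SMachine ((working, ~~ alt, sim_init M1, sim_init M2) : comp_mem) comp_trans.

Lemma comp_never_erases : never_erases M1 -> never_erases M2 -> snever_erases composite.
Proof.
move=> nv1 nv2 [[[ph src] m1] m2] b top /=; case: ph => //=.
rewrite /comp_work /sim_try; case: (omap _ (top in1_front)) => [b1|] /=.
  case E : (act_output _) => [|x|] /=; last by have := nv1 _ _ _ E.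
  - by case: (omap _ _) => [b2|] //=; apply: nv2.
  - by case: (omap _ _) => [b2|] //=; apply: nv2.
by case: (omap _ _) => [b2|] //=; apply: nv2.
Qed.

Variable w : word.

(** n letters of w have been read and M1 has made t1 steps.  The run of M2 so far,
    of t2 steps, is the same on all infinite words that continue the current
    output of M1, since M2 only acts when its next letter is available; one of
    these words is the one that M1 finally writes.  E counts the erasures made
    before M2 was last started. *)
Definition comp_inv (ph : label) (n t1 t2 E : nat) (c : sconfig composite) : Prop :=
  let c1 := (xrun M1 w t1).1 in
  let u1 := cfg_output c1 in
  exists src i j m1 m2,
  [/\ [/\ sc_mem c = (ph, src, m1, m2), sc_input c = n,
       simulates inj1 m1 (fun j => sc_stack c (inl (inl j))) c1 &
       cfg_input c1 <= n /\
       queue (sc_stack c) in1_front in1_back =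
         map bit (drop (cfg_input c1) (mkseq w n))],
      [/\ i <= n, sc_stack c in2_read = map bit (rev (mkseq w i)) &
       queue (sc_stack c) in2_front in2_back = map bit (drop i (mkseq w n))],
      j <= size u1 /\
      queue (sc_stack c) mid_front mid_back = map bit (drop j u1) &
      forall u, (forall k, k < size u1 -> u k = nth false u1 k) ->
        let x2 := xrun M2 (mix alt w u) t2 in
        [/\ simulates inj2 m2 (fun j => sc_stack c (inl (inr j))) x2.1,
            mixstate alt w u (cfg_input x2.1) = (src, i, j),
            sc_output c = cfg_output x2.1 & sc_erasures c = E + x2.2]].

Definition comp_settled (c : sconfig composite) : Prop :=
  [/\ settled (sc_stack c) in1_front in1_back,
      settled (sc_stack c) in2_front in2_back &
      settled (sc_stack c) mid_front mid_back].

Lemma comp_refill n t1 t2 E c : comp_inv refill_in1 n t1 t2 E c ->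
  comp_inv working n t1 t2 E (iter 3 (sstep w) c) /\ comp_settled (iter 3 (sstep w) c).
Proof.
case: c => m pos stk out ers.
move=> [src [i [j [m1 [m2 /= [[-> -> S1 [le1 Q1]] [le2 Q2 Q2'] [le3 Q3] S2]]]]]].
rewrite /= /sstep /= !refill_output !cats0 !addn0.
have [EA sA dA] := @refillP _ _ stk in1_front in1_back isT.
set s1 := transfer_stacks _ stk in EA sA dA *.
have [EB sB dB] := @refillP _ _ s1 in2_front in2_back isT.
set s2 := transfer_stacks _ s1 in EB sB dB *.
have [EQ sQ dQ] := @refillP _ _ s2 mid_front mid_back isT.
set s3 := transfer_stacks _ s2 in EQ sQ dQ *.
have E1 : (fun k => s3 (inl (inl k))) = (fun k => stk (inl (inl k))).
  by apply/funext => k; rewrite dQ // dB // dA.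
have E2 : (fun k => s3 (inl (inr k))) = (fun k => stk (inl (inr k))).
  by apply/funext => k; rewrite dQ // dB // dA.
split.
  exists src, i, j, m1, m2; rewrite /= E1 E2; split=> //; split=> //.
  - by split=> //; rewrite /queue !dQ // !dB // -/(queue s1 in1_front in1_back) EA.
  - by rewrite dQ // dB // dA.
  - by rewrite /queue !dQ // -/(queue s2 in2_front in2_back) EB /queue !dA.
  - by rewrite EQ /queue !dB // !dA.
by split; rewrite //= /settled ?dQ // ?dB.
Qed.

(** M1 lags one round behind the input: in round 0 its queue is still empty, and in
    round n it makes its step number n.-1. *)
Definition comp_restarts (n : nat) : bool :=
  (0 < n) && erasing (act_output (cfg_action w (xrun M1 w n.-1).1)).

(** The default value beyond u is never read: the position of M2 in the second word
    is at most the length of u. *)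
Definition comp_ready (n t2 : nat) (u : seq bool) : bool :=
  let v := nth false u in
  let: (src, i, j) := mixstate alt w v (cfg_input (xrun M2 (mix alt w v) t2).1) in
  if src then j < size u else i < n.

(** Since M1 makes at most one move of its head per round, in which one letter is
    queued, it never has to wait after round 0; M2 steps exactly when it is
    ready. *)
Lemma comp_step n t2 E c : comp_inv working n n.-1 t2 E c -> comp_settled c ->
  if comp_restarts n then
    exists E', comp_inv refill_in1 n.+1 n 0 E' (sstep w c)
  else exists2 t2', comp_inv refill_in1 n.+1 n t2' E (sstep w c) &
    t2' = if comp_ready n t2 (cfg_output (xrun M1 w n.-1).1) then t2.+1 else t2.
Proof.
case: c => m pos stk out ers.
move=> [src [i [j [m1 [m2 /= [[-> -> S1 [le1 Q1]] [le2 Q2 Q2'] [le3 Q3] S2]]]]]].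
move=> [/= sA sB sQ].
rewrite /comp_restarts; set x1 := xrun M1 w n.-1 in S1 le1 Q1 le3 Q3 S2 *.
have topA : omap prjb (ohead (stk in1_front)) =
    if 0 < n then Some (w (cfg_input x1.1)) else None.
  rewrite (settled_top sA) Q1; case: ifP => n0.
    by rewrite drop_mkseq //; apply: leq_ltn_trans (input_le _ _ _) _; case: (n) n0.
  by case: (n) n0 => //; rewrite drop_oversize.
have x1E : xrun M1 w n = if 0 < n then xstep w x1 else x1.
  by rewrite /x1; case: (n) => //= k; rewrite xrunS.
have := @sim_tryP M1 _ inj1 prj1 (fun=> erefl) m1 _
  (omap prjb (ohead (stk in1_front))) x1 w S1.
rewrite topA /sstep /sc_action /= /comp_work topA /=.
case: (sim_try inj1 _ _ _ _) => [[[m1' adv1] ops1] out1] [].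
  by move=> b; case: ifP => // _ [].
have -> : (if if 0 < n then Some (w (cfg_input x1.1)) else None then xstep w x1 else x1)
          = xrun M1 w n by rewrite x1E; case: (0 < n).
move=> S1' pos1 out1E er1 av1.
have -> : (0 < n) && erasing (act_output (cfg_action w x1.1)) = erasing out1.
  move: er1; rewrite x1E; case: (0 < n) => /=; first by do 2 case: erasing => //=; lia.
  by case: erasing => //=; lia.
have AFn : adv1 -> stk in1_front <> [::].
  by move/av1 => av AF0; move: topA av; rewrite AF0 /=; case: ifP.
have le1' : cfg_input (xrun M1 w n).1 <= n := input_le _ _ _.
have Q1' : apply_op (if adv1 then Pop else Keep) (stk in1_front) ++
    rev (bit (w n) :: stk in1_back) =
    map bit (drop (cfg_input (xrun M1 w n).1) (mkseq w n.+1)).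
  rewrite mkseqS pos1; apply: (queue_push _ _ (queue_pop Q1 AFn)).
  by rewrite size_mkseq -pos1.
have EBR : stk in2_read = rev (map bit (mkseq w i)) by rewrite Q2 map_rev.
case er : (erasing out1) => /=.
  exists (ers + 1), (~~ alt), 0, 0, m1', (sim_init M2) => /=.
  have u0 : cfg_output (xrun M1 w n).1 = [::] by rewrite out1E; case: (out1) er.
  have QB' : catrev (stk in2_read) (stk in2_front) ++ rev (bit (w n) :: stk in2_back)
      = map bit (mkseq w n.+1).
    rewrite catrevE rev_cons -catA -rcons_cat -/(queue stk in2_front in2_back) Q2' EBR revK.
    by rewrite -map_rcons -map_cat -rcons_cat mkseqS cat_mkseq_drop.
  split.
  - split; [by [] | by rewrite addn1 | | split; first exact: leqW].
      by under eq_fun do rewrite !indexE.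
    by rewrite /queue !indexE.
  - by split=> //; rewrite /queue !indexE.
  - by rewrite /queue !indexE u0.
  - move=> u _ /=; split=> //; last by rewrite addn0.
    by apply: simulates_init => k; rewrite !indexE.
have topS : omap prjb (ohead (stk (if src then mid_front else in2_front))) =
  if (if src then j < size (cfg_output x1.1) else i < n)
  then Some (if src then nth false (cfg_output x1.1) j else w i) else None.
  case: (src).
    rewrite (settled_top sQ) Q3; case: ltnP => lt; last by rewrite drop_oversize.
    by rewrite (drop_nth false).
  rewrite (settled_top sB) Q2'; case: ltnP => lt; first by rewrite drop_mkseq.
  by rewrite drop_oversize ?size_mkseq.
have readyE : comp_ready n t2 (cfg_output x1.1) =
    (if src then j < size (cfg_output x1.1) else i < n).
  rewrite /comp_ready.
  by have [_ -> _ _] := S2 (nth false (cfg_output x1.1)) (fun _ _ => erefl).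
rewrite topS; set o := (if _ then Some _ else None).
case Etry : (sim_try inj2 _ _ _ _) => [[[m2' adv2] ops2] out2] /=.
have oP : isSome o = comp_ready n t2 (cfg_output x1.1).
  by rewrite readyE /o; move: (if src then _ else _); case.
eexists; last by reflexivity.
have adv_ready : adv2 -> if src then j < size (cfg_output x1.1) else i < n.
  move=> a2; rewrite -readyE -oP; move: a2 Etry; rewrite /sim_try.
  by case: (o) => // -> [].
have oE : adv2 -> odflt false o = if src then nth false (cfg_output x1.1) j else w i.
  by move/adv_ready; rewrite /o => ->.
have growu : size (cfg_output x1.1) <= size (cfg_output (xrun M1 w n).1).
  by rewrite out1E; case: (out1) er => //= x _; rewrite size_rcons.
exists (if adv2 then switch alt src (odflt false o) else src), (i + (adv2 && ~~ src)),
  (j + (adv2 && src)), m1', m2' => /=.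
split.
- by split; rewrite ?addn1 //; split; first exact: leqW.
- split.
  + by rewrite -(addn1 n) leq_add // leq_b1.
  + case A : (adv2 && ~~ src) => /=; last by rewrite addn0.
    case/andP: A => a2 /negbTE s0; move: (oE a2); rewrite s0 => ->.
    by rewrite Q2 addn1 mkseqS rev_rcons.
  + have A : adv2 && ~~ src -> i < n.
      by case/andP=> a2 /negbTE s0; move: (adv_ready a2); rewrite s0.
    rewrite mkseqS; apply: queue_push; first by rewrite size_mkseq; exact: leq_addb.
    apply: (queue_pop Q2') => a2 F0; move: (A a2) => lt.
    by move: Q2'; rewrite /queue F0 (sB F0) drop_mkseq.
- have A : adv2 && src -> j < size (cfg_output x1.1).
    by case/andP=> a2 s0; move: (adv_ready a2); rewrite s0.
  have lej : j + (adv2 && src) <= size (cfg_output x1.1).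
    exact: leq_addb.
  split; first exact: leq_trans growu.
  have Q3' : apply_op (if adv2 && src then Pop else Keep) (stk mid_front) ++
      rev (stk mid_back) = map bit (drop (j + (adv2 && src)) (cfg_output x1.1)).
    apply: (queue_pop Q3) => a2 F0; move: (A a2) => lt.
    by move: Q3; rewrite /queue F0 (sQ F0) (drop_nth false).
  rewrite /queue out1E; case: (out1) er => [|x|] //= _.
  exact: queue_push.
- move=> u Hu /=.
  have Hu1 k : k < size (cfg_output x1.1) -> u k = nth false (cfg_output x1.1) k.
    move=> lt; rewrite Hu; last exact: leq_trans lt growu.
    by rewrite out1E; case: (out1) er => [|x|] //= _; rewrite nth_rcons lt.
  have [S2u mixu outu ersu] := S2 u Hu1.
  set x2 := xrun M2 (mix alt w u) t2 in S2u mixu outu ersu.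
  have bitu : (if src then j < size (cfg_output x1.1) else i < n) ->
     mix alt w u (cfg_input x2.1) = if src then nth false (cfg_output x1.1) j else w i.
    by rewrite /mix mixu /=; case: (src) => // lt; rewrite Hu1.
  have := @sim_tryP M2 _ inj2 prj2 (fun=> erefl) m2 _ o x2 (mix alt w u) S2u.
  rewrite Etry => - [].
    by move=> b; rewrite /o; case: ifP => // av [<-]; rewrite bitu.
  have -> : (if o then xstep (mix alt w u) x2 else x2) =
     xrun M2 (mix alt w u) (if comp_ready n t2 (cfg_output x1.1) then t2.+1 else t2).
    by rewrite -oP; case: (isSome o) => //; rewrite xrunS.
  move=> S2' pos2 out2E er2 _; split=> //.
  + rewrite pos2; case a2 : (adv2); last by rewrite !addn0.
    rewrite addn1 mixstateS mixu bitu ?adv_ready //= oE //.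
  + by rewrite cats0 out2E outu.
  + by rewrite er2 ersu addnA.
Qed.

Lemma srun_iter (S : smachine) (v : word) m n :
  srun S v (m + n) = iter m (sstep v) (srun S v n).
Proof. by rewrite /srun iterD. Qed.

Lemma comp_run0 :
  comp_inv working 0 0 0 0 (srun composite w 0) /\ comp_settled (srun composite w 0).
Proof.
split; last by [].
by exists (~~ alt), 0, 0, (sim_init M1), (sim_init M2).
Qed.

Lemma comp_round n t2 E :
  comp_inv working n n.-1 t2 E (srun composite w (4 * n)) ->
  comp_settled (srun composite w (4 * n)) ->
  (if comp_restarts n then
    exists E', comp_inv working n.+1 n 0 E' (srun composite w (4 * n.+1))
  else comp_inv working n.+1 n
    (if comp_ready n t2 (cfg_output (xrun M1 w n.-1).1) then t2.+1 else t2)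
    E (srun composite w (4 * n.+1))) /\ comp_settled (srun composite w (4 * n.+1)).
Proof.
move=> I Sc; rewrite mulnS (srun_iter _ _ 4).
have := comp_step I Sc; case: ifP => _.
  by move=> [E' /comp_refill [I' Sc']]; split=> //; exists E'.
by move=> [t2' + t2E] => /comp_refill; rewrite t2E.
Qed.

Lemma comp_inv_exists n : exists t2 E,
  comp_inv working n n.-1 t2 E (srun composite w (4 * n)) /\
  comp_settled (srun composite w (4 * n)).
Proof.
elim: n => [|n [t2 [E [I Sc]]]]; first by exists 0, 0; exact: comp_run0.
have := comp_round I Sc; case: ifP => _.
  by move=> [[E' I'] Sc']; exists 0, E'.
by move=> I'; eexists; exists E; exact: I'.
Qed.

(** After the last erasure of M1 the second machine is not restarted any more, and
    each of its steps is made at some time: the letter that it waits for is a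
    letter of w, which will be read, or a letter of u, which M1 will write. *)
Theorem comp_swrites u v : writes M1 w u -> writes M2 (mix alt w u) v ->
  swrites composite w v.
Proof.
move=> W1 W2.
have [n1 [noer out grow]] := writes_stable W1.
pose inv n t2 E := comp_inv working n n.-1 t2 E (srun composite w (4 * n))
   /\ comp_settled (srun composite w (4 * n)).
have [t0 [E I0]] : exists t0 E, inv n1.+1 t0 E := comp_inv_exists n1.+1.
have agree n k : n1 < n -> k < size (cfg_output (xrun M1 w n.-1).1) ->
   u k = nth false (cfg_output (xrun M1 w n.-1).1) k.
  by move=> le lt; rewrite out ?nth_mkseq //; lia.
have next n t : n1 < n -> inv n t E -> exists2 t', inv n.+1 t' E &
    t' = if comp_ready n t (cfg_output (xrun M1 w n.-1).1) then t.+1 else t.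
  move=> le [I Sc]; have := comp_round I Sc.
  rewrite /comp_restarts (negbTE (noer n.-1 _)) ?andbF; last by lia.
  by move=> I'; eexists; first exact: I'.
have advance n t : n1 < n -> inv n t E -> exists2 n', n1 < n' & inv n' t.+1 E.
  move=> le I; have [src [i [j [m1 [m2 [_ _ _ H]]]]]] := I.1.
  have [N leN szN] := grow (maxn (maxn i j) n).+1.
  (* While M2 waits, its reading position (src, i, j) does not change. *)
  have ready m : n1 < m -> inv m t E -> i < m ->
      j < size (cfg_output (xrun M1 w m.-1).1) ->
      comp_ready m t (cfg_output (xrun M1 w m.-1).1).
    move=> lem [[src' [i' [j' [m1' [m2' [_ _ _ H']]]]]] _] im jm.
    have [_ E1 _ _] := H u (fun k => agree n k le).
    have [_ E2 _ _] := H' u (fun k => agree m k lem).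
    have [_ E3 _ _] := H' _ (fun k _ => erefl).
    by move: E2; rewrite /comp_ready E3 E1 => - [<- <- <-]; case: (src).
  have big : maxn (maxn i j) n < N := leq_trans szN (size_output_le _ _ _).
  have wait m : (exists2 n', n1 < n' & inv n' t.+1 E) \/ inv (n + m) t E.
    elim: m => [|m [?|I']]; [by right; rewrite addn0 | by left |].
    have lem : n1 < n + m by exact: ltn_addr.
    have [t' I''] := next _ _ lem I'; case: ifP => _ tE; rewrite tE in I''.
      by left; exists (n + m).+1 => //; exact: leqW.
    by right; rewrite addnS.
  have [//|] := wait (N.+1 - n).
  have nN : n <= N.+1 by move: big; rewrite gtn_max => /andP [_ /ltnW/leqW].
  rewrite subnKC // => I'.
  have lem : n1 < N.+1 by [].
  have [t' I''] := next _ _ lem I'; rewrite ready //.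
  - by move=> tE; rewrite tE in I''; exists N.+2 => //; exact: leqW.
  - by move: big; rewrite !gtn_max -andbA => /and3P [? _ _]; exact: leqW.
  - by apply: leq_trans szN; rewrite ltnS -maxnA maxnCA leq_maxl.
have reach t : t0 <= t -> exists2 n, n1 < n & inv n t E.
  move/subnK <-; elim: (t - t0) => [|m [n le I]]; first by exists n1.+1.
  by rewrite addSn; exact: advance le I.
have [e2 H2] := W2; exists (E + e2) => k.
have [T [ET PT]] := H2 (maxn k t0).
have [|n le [I _]] := reach T.
  have := leq_trans (size_prefix PT) (size_output_le _ _ _).
  by rewrite size_mkseq; apply: leq_trans; exact: leq_maxr.
exists (4 * n).
have [src [i [j [m1 [m2 [_ _ _ H]]]]]] := I.
have [_ _ -> ->] := H u (fun k => agree n k le).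
rewrite ET; split=> //; apply: prefix_trans PT.
by apply: mkseq_prefix; exact: leq_maxl.
Qed.
End Composition.

(** * The least number not enumerated *)

(** The set of enumerated numbers is kept as a bit sequence.  Reading the block of
    v.+1 walks v cells along it, extending it if necessary, and marks the cell
    reached; then the number of leading marks is written, by another walk. *)
Section LeastMachine.
Local Notation marks := L0.
Local Notation passed := L1.
Local Notation reading := L0.
Local Notation walking := L1.
Local Notation reporting := L2.
Definition two_ops (f b : stack_op bool) (i : label) : stack_op bool :=
  match i with marks => f | passed => b | _ => Keep end.

Definition least_trans (q : label) (b : bool) (top : label -> option bool) :
    saction label bool label :=
  let back : transfer label := Some (passed, [set marks], false) in
  match q with
  | reading => SAction (if b then walking else reporting) true (fun=> Keep) OutNone None
  | walking =>
      if b then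
        SAction walking true (two_ops Pop (Push (odflt false (top marks)))) OutNone None
      else SAction reporting true (two_ops Pop (Push true)) OutNone back
  | _ =>
      if top marks is Some true then
        SAction reporting false (two_ops Pop (Push true)) (OutWrite true) None
      else SAction reading false (fun=> Keep) (OutWrite false) back
  end.

Definition least : smachine := @SMachine label reading label bool least_trans.

Lemma least_never_erases : snever_erases least.
Proof. by case=> // [] [] top //=; case: (top marks) => [[]|]. Qed.

Section Least.
Variable w : word.

Definition least_at (q : label) (pos : nat) (r l : seq bool) (out : seq bool)
    (c : sconfig least) : Prop :=
  [/\ sc_mem c = q, sc_input c = pos, sc_stack c marks = r /\ sc_stack c passed = l,
      sc_output c = out & sc_erasures c = 0].

Lemma least_start pos r out c : least_at reading pos r [::] out c ->
  least_at (if w pos then walking else reporting) pos.+1 r [::] out (sstep w c).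
Proof.
case: c => m p s o e [/= -> -> [Er El] -> ->]; rewrite /sstep /sc_action /=.
by split; rewrite /= ?cats0 ?addn1 ?Er.
Qed.

Lemma least_next pos r l out c : w pos -> least_at walking pos r l out c ->
  least_at walking pos.+1 (behead r) (head false r :: l) out (sstep w c).
Proof.
case: c => m p s o e wp [/= -> -> [Er El] -> ->]; rewrite /sstep /sc_action /= wp.
by split; rewrite /= ?cats0 ?addn1 ?Er ?El //; split=> //; case: (r).
Qed.

Lemma least_mark pos r l out c : ~~ w pos -> least_at walking pos r l out c ->
  least_at reporting pos.+1 (catrev l (true :: behead r)) [::] out (sstep w c).
Proof.
case: c => m p s o e /negbTE wp [/= -> -> [Er El] -> ->].
rewrite /sstep /sc_action /= wp.
by split; rewrite /= ?cats0 ?addn1 ?Er ?El //; split; rewrite ?indexE /= ?Er ?El.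
Qed.

(** The first letter of the block has been read already, so that k more letters
    lead to cell k. *)
Lemma least_walk k : forall pos r l out c, least_at walking pos r l out c ->
  (forall i, i < k -> w (pos + i)) -> ~~ w (pos + k) ->
  least_at reporting (pos + k.+1) (catrev l (set_nth false r k true)) [::] out
    (iter k.+1 (sstep w) c).
Proof.
elim: k => [|k IH] pos r l out c I ones zero.
  by rewrite addn0 in zero; have := least_mark zero I; rewrite addn1; case: (r).
have w0 : w pos by have := ones 0 isT; rewrite addn0.
rewrite iterSr addnS -addSn.
have -> : catrev l (set_nth false r k.+1 true) =
  catrev (head false r :: l) (set_nth false (behead r) k true).
  by case: (r) => [|//]; case: (k).
apply: (IH _ _ _ _ _ (least_next w0 I)); last by rewrite addSnnS.
by move=> i lt; rewrite addSnnS; apply: ones.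
Qed.

Lemma least_emit r : forall pos l out c, least_at reporting pos r l out c ->
  least_at reading pos (catrev l r) [::] (out ++ unary_block (find negb r))
    (iter (find negb r).+1 (sstep w) c).
Proof.
elim: r => [|[] r IH] pos l out c I.
- case: c I => m p s o e [/= -> -> [Er El] -> ->]; rewrite /sstep /sc_action /= Er.
  by split; rewrite /= ?cats0 ?addn0 -?cats1 //; split; rewrite ?indexE /= ?Er ?El.
- rewrite iterSr [find _ _]/=; set k := find negb r.
  have -> : out ++ unary_block k.+1 = rcons out true ++ unary_block k.
    by rewrite cat_rcons.
  apply: (IH _ (true :: l)).
  case: c I => m p s o e [/= -> -> [Er El] -> ->]; rewrite /sstep /sc_action /= Er.
  by split; rewrite /= ?cats0 ?addn0 ?Er ?El.
- case: c I => m p s o e [/= -> -> [Er El] -> ->]; rewrite /sstep /sc_action /= Er.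
  by split; rewrite /= ?cats0 ?addn0 -?cats1 //; split; rewrite ?indexE /= ?Er ?El.
Qed.
End Least.

(** The contents of the bit sequence after s blocks. *)
Fixpoint marked (h : baire) (s : nat) : seq bool :=
  if s is s'.+1 then
    if h s' is n.+1 then set_nth false (marked h s') n true else marked h s'
  else [::].

Definition least_seq (h : baire) : baire := fun s => find negb (marked h s.+1).

Lemma least_block h s c out :
  least_at reading (size (unary_prefix h s)) (marked h s) [::] out c ->
  exists n, least_at reading (size (unary_prefix h s.+1)) (marked h s.+1) [::]
    (out ++ unary_block (least_seq h s)) (iter n (sstep (unary h)) c).
Proof.
move=> I; suff [n In] : exists n, least_at reporting (size (unary_prefix h s.+1))
    (marked h s.+1) [::] out (iter n (sstep (unary h)) c).
  exists ((find negb (marked h s.+1)).+1 + n); rewrite iterD.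
  exact: least_emit In.
have := least_start (unary h) I.
rewrite -{1}[size _]addn0 unary_letter // unary_prefixS size_cat size_rcons size_nseq /=.
case E : (h s) => [|v] /= I1; first by exists 1; rewrite addn1.
exists v.+2; rewrite iterSr addnS -addSn.
apply: (least_walk I1).
  by move=> i lt; rewrite addSnnS unary_letter E ?ltnS // ltnW.
by rewrite addSnnS unary_letter E // ltnn.
Qed.

Lemma least_swrites h : swrites least (unary h) (unary (least_seq h)).
Proof.
have H k : exists n, least_at reading (size (unary_prefix h k)) (marked h k) [::]
    (unary_prefix (least_seq h) k) (srun least (unary h) n).
  elim: k => [|k [n /least_block [n' I]]]; first by exists 0.
  by exists (n' + n); rewrite srun_iter (unary_prefixS (least_seq h)).
exists 0 => k; have [n [_ _ _ Eo Ee]] := H k; exists n; rewrite Eo; split=> //.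
by rewrite unary_prefixE; apply: mkseq_prefix; exact: size_unary_prefix.
Qed.

Lemma nth_marked h s n : nth false (marked h s) n = [exists i : 'I_s, h i == n.+1].
Proof.
elim: s => [|s IH] /=.
  by rewrite nth_nil; apply/esym/existsP => - [[]].
have -> : [exists i : 'I_s.+1, h i == n.+1] =
    [exists i : 'I_s, h i == n.+1] || (h s == n.+1).
  apply/existsP/orP => [[i Hi]|[/existsP [i Hi]|Hs]].
  - move: Hi; case: (ltngtP i s) (ltn_ord i) => [lt _ Hi|gt|-> _ ->]; last by right.
      by left; apply/existsP; exists (Ordinal lt).
    by rewrite ltnS leqNgt gt.
  - by exists (widen_ord (leqnSn s) i).
  - by exists ord_max.
rewrite -IH; case: (h s) => [|v]; first by rewrite orbF.
by rewrite nth_set_nth /= eqSS eq_sym; case: eqP; rewrite ?orbT ?orbF.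
Qed.

(** Below a there are only finitely many numbers, so that all of them have been
    enumerated from some stage on. *)
Lemma least_seq_limit h a : (forall k, h k <> a.+1) ->
  (forall m, m < a -> exists k, h k = m.+1) ->
  exists s0, forall s, s0 <= s -> least_seq h s = a.
Proof.
move=> Ha Hm.
have [s0 H0] : exists s0, forall m, m < a -> exists2 k, k < s0 & h k = m.+1.
  elim: {Ha} a Hm => [|a IH] Hm; first by exists 0.
  have [s0 H0] := IH (fun m lt => Hm m (leqW lt)).
  have [k Hk] := Hm a (leqnn _).
  exists (maxn s0 k.+1) => m; rewrite ltnS leq_eqVlt => /predU1P [->|/H0 [k' lt E]].
    by exists k => //; rewrite leq_max leqnn orbT.
  by exists k' => //; rewrite leq_max lt.
exists s0 => s le; rewrite /least_seq.
have Na : nth false (marked h s.+1) a = false.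
  by rewrite nth_marked; apply/existsP => - [i /eqP /Ha].
have Nm m : m < a -> nth false (marked h s.+1) m.
  move=> /H0 [k lt E]; rewrite nth_marked; apply/existsP.
  have lk : k < s.+1 by exact: leq_trans lt (leqW le).
  by exists (Ordinal lk); rewrite /= E.
apply/eqP; rewrite eqn_leq; apply/andP; split; rewrite leqNgt; apply/negP => lt.
  by have := before_find false lt; rewrite Na.
have := Nm _ lt; case: (boolP (has negb (marked h s.+1))) => [hn|hn].
  by rewrite (negbTE (nth_find false hn)).
by rewrite nth_default // hasNfind.
Qed.
End LeastMachine.

(** * The discrete limit with finitely many mind changes *)

(** What the machine for the limit does to the row that it guesses, apart from its
    counting of diagonals.  The part of the row not yet compared in this diagonal
    is row_next; the part already compared or just appended is row_done, last
    letter first.  With row_skip the rest of the diagonal is ignored. *)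
Record rowstate : Type := Row {
  row_skip : bool; row_next : seq bool; row_done : seq bool;
  row_out : seq bool; row_ers : nat }.

(** Encodings of numbers are prefix-free, so that entries can be compared letter by
    letter.  Once row_next is exhausted the next entry of the diagonal belongs to
    the guessed row itself, and is appended and written. *)
Definition row_read (st : rowstate) (b : bool) : rowstate :=
  let: Row sk rf rr o e := st in
  if sk then st else
  if rf is x :: rf' then
    if x == b then Row false rf' (b :: rr) o e else Row true [::] [::] [::] e.+1
  else Row (~~ b) [::] (b :: rr) (rcons o b) e.

Lemma row_read_skip s rf rr o e :
  foldl row_read (Row true rf rr o e) s = Row true rf rr o e.
Proof. by elim: s. Qed.

Lemma row_read_same s rf rr o e :
  foldl row_read (Row false (s ++ rf) rr o e) s = Row false rf (catrev s rr) o e.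
Proof. by elim: s rr => //= x s IH rr; rewrite eqxx IH. Qed.

Lemma row_read_other a v rf rr o e : a != v ->
  foldl row_read (Row false (unary_block a ++ rf) rr o e) (unary_block v) =
  Row true [::] [::] [::] e.+1.
Proof.
by elim: a v rr => [|a IH] [|v] rr //=; [rewrite row_read_skip | rewrite eqSS; exact: IH].
Qed.

Lemma row_read_new v rr o e :
  foldl row_read (Row false [::] rr o e) (unary_block v) =
  Row true [::] (catrev (unary_block v) rr) (o ++ unary_block v) e.
Proof.
elim: v rr o => [|v IH] rr o /=; first by rewrite cats1.
by rewrite IH cat_rcons.
Qed.

Definition row_rewind (st : rowstate) : rowstate :=
  let: Row sk rf rr o e := st in Row false (catrev rr rf) [::] o e.

Section LimitMachine.
Local Notation unread := L0.
Local Notation reread := L1.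
Local Notation ahead := L2.
Local Notation behind := L3.

(** The stacks ahead and behind together have as many letters as the number of the
    current diagonal; one letter is moved at the end of each entry, and the
    diagonal is complete when an entry ends with nothing ahead. *)
Definition lim_ops (sk b : bool) (top : label -> option bool) (i : label) : stack_op bool :=
  match i with
  | unread => if sk then Keep else
          if top unread is Some x then if x == b then Pop else Clear else Keep
  | reread => if sk then Keep else
          if top unread is Some x then if x == b then Push b else Clear else Push b
  | ahead => if b then Keep else Pop
  | behind => if b then Keep else Push true
  | _ => Keep
  end.

Definition lim_trans (q : bool * bool) (b : bool) (top : label -> option bool) :
    saction (bool * bool : finType) bool label :=
  let: (rewinding, sk) := q in
  if rewinding then
    SAction ((false, false) : (bool * bool : finType)) false (fun=> Keep) OutNone
      (Some (reread, [set unread], false))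
  else
    let last := ~~ b && (top ahead == None) in
    SAction ((last, sk || (if top unread is Some x then x != b else ~~ b))
                : (bool * bool : finType)) true (lim_ops sk b top)
      (if sk then OutNone else
       if top unread is Some x then if x == b then OutNone else OutErase
       else OutWrite b)
      (if last then Some (behind, [set ahead], false) else None).

Definition limit : smachine :=
  SMachine ((false, false) : (bool * bool : finType)) lim_trans.

Section Limit.
Variable w : word.

Definition lim_at (rewinding : bool) (pos : nat) (st : rowstate) (df dr : seq bool)
    (c : sconfig limit) : Prop :=
  [/\ sc_mem c = (rewinding, row_skip st), sc_input c = pos,
      [/\ sc_stack c unread = row_next st, sc_stack c reread = row_done st,
          sc_stack c ahead = df & sc_stack c behind = dr],
      sc_output c = row_out st & sc_erasures c = row_ers st].

(** The end of the last entry of a diagonal also adds one letter to the count, as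
    the next diagonal has one entry more. *)
Lemma lim_read pos st df dr c : lim_at false pos st df dr c -> 
  if w pos then lim_at false pos.+1 (row_read st true) df dr (sstep w c)
  else if df is _ :: df' then
    lim_at false pos.+1 (row_read st false) df' (true :: dr) (sstep w c)
  else lim_at true pos.+1 (row_read st false) (rev (true :: dr)) [::] (sstep w c).
Proof.
case: st => sk rf rr o e; case: c => m p s o' e' [/= -> -> [E0 E1 E2 E3] -> ->].
have Et2 : (ohead (s ahead) == None) = (df == [::]) by rewrite E2; case: (df).
rewrite /sstep /sc_action /= Et2 E0.
case: (w pos) => /=; last case: df E2 {Et2} => [|y df'] E2 /=.
all: case: sk; last case: rf E0 => [|[] rf'] E0 /=.
all: by do ?split; rewrite /= ?indexE /= ?cats0 ?addn1 ?addn0 ?E0 ?E1 ?E2 ?E3.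
Qed.

Lemma lim_rewind pos st df dr c : lim_at true pos st df dr c ->
  lim_at false pos (row_rewind st) df dr (sstep w c).
Proof.
case: st => sk rf rr o e; case: c => m p s o' e' [/= -> -> [E0 E1 E2 E3] -> ->].
rewrite /sstep /sc_action /=; split; rewrite ?cats0 ?addn0 //=.
by split; rewrite ?indexE /= ?E0 ?E1 ?E2 ?E3.
Qed.
End Limit.

Lemma nseq_rcons (T : Type) n (x : T) : nseq n.+1 x = rcons (nseq n x) x.
Proof. by elim: n => //= n <-. Qed.

Lemma lim_block h k st df dr c :
  lim_at false (size (unary_prefix h k)) st df dr c ->
  exists n, let c' := iter n (sstep (unary h)) c in
  let st' := foldl row_read st (unary_block (h k)) in
  if df is _ :: df' then lim_at false (size (unary_prefix h k.+1)) st' df' (true :: dr) c'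
  else lim_at true (size (unary_prefix h k.+1)) st' (rev (true :: dr)) [::] c'.
Proof.
move=> I; exists (h k).+1.
have H v : v <= h k -> lim_at false (size (unary_prefix h k) + v)
    (foldl row_read st (nseq v true)) df dr (iter v (sstep (unary h)) c).
  elim: v => [|v IH] lt; first by rewrite addn0.
  have /(lim_read (unary h)) := IH (ltnW lt).
  by rewrite unary_letter ?(ltnW lt) // lt addnS nseq_rcons foldl_rcons iterS.
have /(lim_read (unary h)) := H _ (leqnn _).
rewrite unary_letter // ltnn /= unary_prefixS size_cat size_rcons size_nseq addnS.
by rewrite /unary_block foldl_rcons; case: (df).
Qed.

(** Cantor's pairing enumerates the pairs diagonal by diagonal; diagonal d starts at
    tri d and consists of the pairs (d - y, y) for y from 0 to d. *)
Fixpoint tri (d : nat) : nat := if d is d'.+1 then tri d' + d else 0.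

Definition diagonal (h : baire) (d n : nat) : seq bool :=
  flatten [seq unary_block (h (tri d + y)) | y <- iota 0 n].

Lemma diagonalS h d n : diagonal h d n.+1 = diagonal h d n ++ unary_block (h (tri d + n)).
Proof. by rewrite /diagonal -addn1 iotaD map_cat flatten_cat /= cats0. Qed.

Lemma lim_diagonal h d st c :
  lim_at false (size (unary_prefix h (tri d))) st (nseq d true) [::] c ->
  exists n, lim_at false (size (unary_prefix h (tri d.+1)))
    (row_rewind (foldl row_read st (diagonal h d d.+1)))
    (nseq d.+1 true) [::] (iter n (sstep (unary h)) c).
Proof.
move=> I.
have H y : y <= d -> exists n, lim_at false (size (unary_prefix h (tri d + y)))
    (foldl row_read st (diagonal h d y)) (nseq (d - y) true) (nseq y true)
    (iter n (sstep (unary h)) c).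
  elim: y => [|y IH] lt; first by exists 0; rewrite addn0 subn0.
  have [n /lim_block [n']] := IH (ltnW lt).
  rewrite -[d - y]prednK ?subn_gt0 //= => I'; exists (n' + n).
  by rewrite iterD diagonalS foldl_cat addnS subnS.
have [n /lim_block [n']] := H d (leqnn _); rewrite subnn /= => I'.
exists (1 + (n' + n)); rewrite iterD /= iterD.
have := lim_rewind (unary h) I'.
by rewrite diagonalS foldl_cat addnS rev_cons rev_nseq -nseq_rcons.
Qed.

Lemma btuple_diagonal ps d y : y <= d -> btuple ps (tri d + y) = ps (d - y) y.
Proof.
move=> le; have E : Cantor.to_nat (d - y, y) = tri d + y.
  have T k : tri k * 2 = k * k.+1 by elim: k => //= k IH; rewrite mulnDl IH; lia.
  have := Cantor.to_nat_spec (d - y) y; have -> : Nat.add y (d - y) = d by lia.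
  have := T d; lia.
by rewrite /btuple -E Cantor.cancel_of_to.
Qed.

Lemma diagonal_agree ps r d y : y <= d.+1 ->
  (forall z, z < y -> ps (d - z) z = r z) ->
  diagonal (btuple ps) d y = unary_prefix r y.
Proof.
elim: y => // y IH lt H; rewrite diagonalS unary_prefixS.
rewrite IH ?(ltnW lt) //; last by move=> z zy; apply: H; exact: ltnW.
by rewrite btuple_diagonal // H.
Qed.

Lemma diagonal_split h d m n : m <= n ->
  exists s, diagonal h d n = diagonal h d m ++ s.
Proof.
move/subnK <-; elim: (n - m) => [|k [s IH]]; first by exists [::]; rewrite cats0.
by rewrite addSn diagonalS IH -catA; eexists.
Qed.

(** In diagonal d, d - c entries of row c are known; the next one in the diagonal
    has row index c. *)
Definition agrees (ps : nat -> baire) (c d : nat) : Prop :=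
  forall y, y < d - c -> ps (d - y) y = ps c y.

Definition row_at (ps : nat -> baire) (c d e : nat) : rowstate :=
  let s := unary_prefix (ps c) (d - c) in Row false s [::] s e.

Lemma unary_prefix_split r m n : m <= n ->
  exists s, unary_prefix r n = unary_prefix r m ++ s.
Proof. by move/(unary_prefix_le r)/prefixP. Qed.

Lemma row_agrees ps c d e : c <= d -> agrees ps c d ->
  row_rewind (foldl row_read (row_at ps c d e) (diagonal (btuple ps) d d.+1)) =
  row_at ps c d.+1 e.
Proof.
move=> cd A; have lt : (d - c).+1 <= d.+1 by rewrite ltnS leq_subr.
have [s ->] := diagonal_split (btuple ps) d lt.
rewrite diagonalS (diagonal_agree (r := ps c)) ?(ltnW lt) // /row_at.
rewrite !foldl_cat -{1}[unary_prefix _ _]cats0 row_read_same row_read_new row_read_skip /=.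
rewrite btuple_diagonal ?leq_subr // subKn // subSn // unary_prefixS.
by rewrite !catrevE ?cats0 ?rev_cat !revK.
Qed.

(** After the first mismatch everything up to the end of the diagonal is skipped,
    and the new guess, row d.+1, has its first entry in the next diagonal. *)
Lemma row_disagrees ps c d e : ~ agrees ps c d ->
  row_rewind (foldl row_read (row_at ps c d e) (diagonal (btuple ps) d d.+1)) =
  row_at ps d.+1 d.+1 e.+1.
Proof.
move=> nA; pose P y := (y < d - c) && (ps (d - y) y != ps c y).
have exP : exists y, P y.
  apply: contrapT => nP; apply: nA => y lt; apply/eqP; apply: contraPT isT => ne _.
  by apply: nP; exists y; rewrite /P lt.
have [y /andP [lt ne] least] := ex_minnP exP.
have yd : y.+1 <= d.+1 by rewrite ltnS (leq_trans (ltnW lt)) // leq_subr.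
have [s ->] := diagonal_split (btuple ps) d yd.
rewrite diagonalS (diagonal_agree (r := ps c)) ?(ltnW yd) //; last first.
  move=> z zy; apply/eqP; case: eqP => // /eqP nez.
  have := least z; rewrite /P nez (ltn_trans zy lt) => /(_ isT).
  by rewrite leqNgt zy.
have [t Et] := unary_prefix_split (ps c) lt.
rewrite /row_at Et unary_prefixS btuple_diagonal // !foldl_cat -!catA row_read_same.
by rewrite row_read_other 1?eq_sym // row_read_skip subnn.
Qed.

(** A guess c >= n0 agrees with all later diagonals.  Hence either the guess made at
    diagonal n0 is kept for ever, or the first mismatch after that replaces it by
    one that is kept for ever. *)
Lemma limit_swrites ps q n0 : (forall i, n0 <= i -> ps i = q) ->
  swrites limit (unary (btuple ps)) (unary q).
Proof.
move=> Hq; pose h := btuple ps.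
pose J d c e := c <= d /\ exists n,
  lim_at false (size (unary_prefix h (tri d))) (row_at ps c d e) (nseq d true) [::]
    (srun limit (unary h) n).
have J1 d c e : J d c e -> agrees ps c d -> J d.+1 c e.
  move=> [cd [n /lim_diagonal [n' I]]] A; split; first exact: leqW.
  by exists (n' + n); rewrite srun_iter -row_agrees.
have J2 d c e : J d c e -> ~ agrees ps c d -> J d.+1 d.+1 e.+1.
  move=> [cd [n /lim_diagonal [n' I]]] A; split => //.
  by exists (n' + n); rewrite srun_iter -(row_disagrees _ A).
have late c d : n0 <= c -> agrees ps c d.
  by move=> le y lt; rewrite !Hq //; lia.
(* The final guess c, in force from diagonal d0 on. *)
have [c [e [d0 [Hd A]]]] : exists c e d0,
    (forall d, d0 <= d -> J d c e) /\ (forall d, d0 <= d -> agrees ps c d).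
  have persist c e d0 : J d0 c e -> forall d, d0 <= d ->
      (forall d', d0 <= d' < d -> agrees ps c d') -> J d c e.
    move=> J0 d /subnK <-; elim: (d - d0) => // k IH A.
    rewrite addSn; apply: J1; last by apply: A; rewrite leq_addl addSn ltnS leqnn.
    by apply: IH => d' /andP [le lt]; apply: A; rewrite le addSn ltnS ltnW.
  have [c [e J0]] : exists c e, J n0 c e.
    elim: (n0) => [|k [c [e I]]]; first by exists 0, 0; split=> //; exists 0.
    case: (EM (agrees ps c k)) => A; first by exists c, e; exact: J1.
    by exists k.+1, e.+1; exact: J2 I A.
  case: (EM (forall d, n0 <= d -> agrees ps c d)) => A.
    exists c, e, n0; split=> // d le; apply: (persist _ _ _ J0) => // d' /andP [le' _].
    exact: A.
  have exP : exists d, (n0 <= d) && ~~ `[< agrees ps c d >].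
    apply: contrapT => nP; apply: A => d le; apply: contrapT => nA; apply: nP.
    by exists d; rewrite le asboolF.
  have [d /andP [le /asboolPn nA] least] := ex_minnP exP.
  have Jd : J d c e.
    apply: (persist _ _ _ J0) => // d' /andP [le' lt]; apply: contrapT => nA'.
    by have := least d'; rewrite le' asboolF // => /(_ isT); rewrite leqNgt lt.
  exists d.+1, e.+1, d.+1; have J0' := J2 _ _ _ Jd nA.
  have nd : n0 <= d.+1 by exact: leqW.
  by split=> d' le'; [apply: (persist _ _ _ J0') => // ? _|]; exact: late.
(* Entry j of row c is compared with entry j of row d - j, for d large. *)
have rq : ps c = q.
  apply/funext => j; pose d := maxn d0 (maxn (n0 + j) (c + j).+1).
  have := A d; rewrite -(_ : ps (d - j) j = q j); last by rewrite Hq // /d; lia.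
  by move=> ->; rewrite /d; lia.
exists e => k; have [cd [n [_ _ _ Eo Ee]]] := Hd (maxn d0 (c + k)) (leq_maxl _ _).
exists n; rewrite Ee Eo; split=> //=; rewrite rq unary_prefixE.
apply: mkseq_prefix; apply: leq_trans (size_unary_prefix _ _).
by rewrite leq_subRL // leq_maxr.
Qed.
End LimitMachine.

(** * Splitting a pair *)

(** The entry r 0 of a pair of p and r is put in front of p.  It is the second block
    of the pair, so that the first block, p 0, has to be stored meanwhile.
    Afterwards the blocks of p are echoed and those of r skipped. *)
Section SplitMachine.
Local Notation store := L0.
Local Notation storing := L0.
Local Notation heading := L1.
Local Notation closing := L2.
Local Notation skipping := L3.
Local Notation echoing := L4.

Definition split_trans (q : label) (b : bool) (top : label -> option bool) :
    saction label bool label :=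
  match q with
  | storing => SAction (if b then storing else heading) true
            (fun i => if i is store then if b then Push true else Keep else Keep)
            OutNone None
  | heading => SAction (if b then heading else closing) true (fun=> Keep) (OutWrite b)
            (if b then None else Some (store, finset.set0, true))
  | closing => SAction echoing false (fun=> Keep) (OutWrite false) None
  | skipping => SAction (if b then skipping else echoing) true (fun=> Keep) OutNone None
  | _ => SAction (if b then q else skipping) true (fun=> Keep) (OutWrite b) None
  end.

Definition split_machine : smachine := @SMachine label storing label bool split_trans.

Lemma split_never_erases : snever_erases split_machine.
Proof. by case=> b top. Qed.

Definition consb (n : nat) (p : baire) : baire := fun k => if k is k'.+1 then p k' else n.

Section Split.
Variable x : baire.

Definition split_at (q : label) (k o : nat) (a out : seq bool)
    (c : sconfig split_machine) : Prop :=
  [/\ sc_mem c = q, sc_input c = size (unary_prefix x k) + o, sc_stack c store = a,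
      sc_output c = out & sc_erasures c = 0].

Definition echoes (q : label) : bool := (q != storing) && (q != skipping).

Definition after_block (q : label) : label :=
  match q with
  | storing => heading
  | heading => closing
  | skipping => echoing
  | _ => skipping
  end.

Lemma split_trues q k v a out c : q != closing -> v <= x k -> split_at q k 0 a out c ->
  split_at q k v (if q == storing then nseq v true ++ a else a)
    (if echoes q then out ++ nseq v true else out) (iter v (sstep (unary x)) c).
Proof.
rewrite /echoes !labelE => q2 + I; elim: v => [_|v IH lt].
  by rewrite /= cats0 !if_same.
have := IH (ltnW lt); rewrite iterS.
case: (iter v _ c) => m p s o e [/= -> -> E0 -> ->]; rewrite /sstep /sc_action /=.
rewrite unary_letter ?(ltnW lt) // lt.
by case: q q2 {IH I} E0 => //= _ E0; split; rewrite /= ?E0 ?addn1 ?addnS ?cats0 //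
  ?rcons_cat -?nseq_rcons //=.
Qed.

Lemma split_posS k : size (unary_prefix x k) + x k + 1 = size (unary_prefix x k.+1) + 0.
Proof. by rewrite unary_prefixS size_cat size_rcons size_nseq addn1 addnS addn0. Qed.

Lemma split_zero q k a out c : q != closing -> split_at q k (x k) a out c ->
  split_at (after_block q) k.+1 0
    (if q == heading then [::] else a)
    ((if echoes q then rcons out false else out) ++
     (if q == heading then nseq (size a) true else [::])) (sstep (unary x) c).
Proof.
rewrite /echoes !labelE => q2; case: c => m p s o e [/= -> -> E0 -> ->].
rewrite /sstep /sc_action /= unary_letter // ltnn.
by case: q q2 => //= _; split; rewrite /= ?split_posS ?E0 ?cats0.
Qed.

Lemma split_block q k a out c : q != closing -> split_at q k 0 a out c ->
  let a' := if q == storing then nseq (x k) true ++ a else a in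
  split_at (after_block q) k.+1 0
    (if q == heading then [::] else a')
    ((if echoes q then out ++ unary_block (x k) else out) ++
     (if q == heading then nseq (size a') true else [::]))
    (iter (x k).+1 (sstep (unary x)) c).
Proof.
move=> q2 I; have := split_zero q2 (split_trues q2 (leqnn _) I).
by rewrite /= /unary_block; case: (echoes q); rewrite ?rcons_cat.
Qed.

Lemma split_separator k out c : split_at closing k 0 [::] out c ->
  split_at echoing k 0 [::] (rcons out false) (sstep (unary x) c).
Proof.
case: c => m p s o e [/= -> -> E0 -> ->]; rewrite /sstep /sc_action /=.
by split; rewrite //= ?addn0 ?cats0.
Qed.

Lemma split_start : exists n, split_at echoing 2 0 [::]
  (unary_block (x 1) ++ unary_block (x 0)) (srun split_machine (unary x) n).
Proof.
have I0 : split_at storing 0 0 [::] [::] (srun split_machine (unary x) 0) by [].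
have := split_block (q := storing) isT I0; rewrite -srun_iter /= cats0 => I1.
have := split_block (q := heading) isT I1; rewrite -srun_iter /= => I2.
exists (1 + ((x 1).+1 + ((x 0).+1 + 0))); rewrite srun_iter.
have := split_separator I2; rewrite size_nseq /unary_block.
by rewrite [rcons (_ ++ _) _]rcons_cat.
Qed.

Lemma split_loop k out n : split_at echoing k 0 [::] out (srun split_machine (unary x) n) ->
  exists n', split_at echoing k.+2 0 [::] (out ++ unary_block (x k))
    (srun split_machine (unary x) n').
Proof.
move=> I; have := split_block (q := echoing) isT I; rewrite -srun_iter /= cats0 => I1.
have := split_block (q := skipping) isT I1; rewrite -srun_iter /= cats0 => I2.
by eexists; exact: I2.
Qed.
End Split.

Lemma split_swrites p r :
  swrites split_machine (unary (bpair p r)) (unary (consb (r 0) p)).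
Proof.
set x := bpair p r.
have xe k : x k.*2 = p k by rewrite /x /bpair odd_double doubleK.
have H k : exists n, split_at x echoing k.+1.*2 0 [::] (unary_prefix (consb (r 0) p) k.+2)
    (srun split_machine (unary x) n).
  elim: k => [|k [n /split_loop [n' I]]].
    by have [n I] := split_start x; exists n; rewrite !unary_prefixS /= -xe.
  by exists n'; rewrite (unary_prefixS (consb _ _)) /= -xe.
exists 0 => k; have [n [_ _ _ Eo Ee]] := H k; exists n; rewrite Ee Eo; split=> //.
rewrite unary_prefixE; apply: mkseq_prefix; apply: leq_trans (size_unary_prefix _ _).
by rewrite -addn2 leq_addr.
Qed.
End SplitMachine.

(** * Delaying a machine, and refuting the instants of its erasures *)

Section OneMachine.
Variable M : machine.
Local Notation I := ('I_(ntapes M) * bool)%type.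
Definition one_index : finType := (I + label)%type.
Definition one_letter : finType := (symbol M + bool)%type.
Definition inj_symbol (s : symbol M) : one_letter := inl s.
Definition prj_symbol (g : one_letter) : symbol M := if g is inl s then s else blank M.
Lemma inj_symbolK : cancel inj_symbol prj_symbol. Proof. by []. Qed.
Definition mark : one_letter := inr true.

Local Notation count := (inr L0).

Definition delay_mem : finType := (bool * sim_mem M)%type.

Definition delay_trans (q : delay_mem) (b : bool) (top : one_index -> option one_letter) :
    saction delay_mem one_letter one_index :=
  let: (running, m) := q in
  if running then
    let a := sim_action m b in
    SAction ((true, sim_next prj_symbol a (fun j => top (inl j))) : delay_mem)
      (act_advance a)
      (fun i => match i with inl j => sim_ops inj_symbol a j | count => Pop | _ => Keep end)
      (if top count is Some _ then OutNone
       else if act_output a is OutErase then OutNone else act_output a) None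
  else
    SAction ((~~ b, m) : delay_mem) true
      (fun i => if i is count then if b then Push mark else Keep else Keep) OutNone None.

Definition delay : smachine := SMachine ((false, sim_init M) : delay_mem) delay_trans.

Lemma delay_never_erases : snever_erases delay.
Proof.
by case=> [[] m] b top //=; case: (top count) => //=; case: (act_output _).
Qed.

(** The block in front of w tells for how many steps the output of M is to be
    ignored.  If M has an empty output after these steps, then what is written from
    then on is the output of M. *)
Section Delay.
Variables (w z : word) (n : nat).
Hypothesis zE : (forall i, i < n -> z i) /\ ~~ z n /\ forall i, z (n.+1 + i) = w i.

Lemma delay_count k : k <= n -> srun delay z k =
  SConfig (S := delay) (false, sim_init M) k
    (fun i => if i is count then nseq k mark else [::]) [::] 0.
Proof.
elim: k => [_|k IH lt]; first by congr SConfig; apply/funext => - [?|[]].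
rewrite /srun iterS -/(srun _ _ _) (IH (ltnW lt)) /sstep /sc_action /=.
rewrite (zE.1 _ lt) addn1; congr SConfig.
by apply/funext => - [?|[]].
Qed.

Hypothesis quiet : forall t, n <= t ->
  ~~ erasing (act_output (cfg_action w (xrun M w t).1)).
Hypothesis start_empty : cfg_output (xrun M w n).1 = [::].

Definition delay_at (t : nat) (c : sconfig delay) : Prop :=
  let x := (xrun M w t).1 in
  exists m, [/\ sc_mem c = (true, m), sc_input c = n.+1 + cfg_input x,
    simulates inj_symbol m (fun j => sc_stack c (inl j)) x /\
    sc_stack c count = nseq (n - t) mark,
    sc_output c = (if n <= t then cfg_output x else [::]) & sc_erasures c = 0].

Lemma delay_run t : delay_at t (srun delay z (t + n.+1)).
Proof.
elim: t => [|t].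
  rewrite /srun iterS -/(srun _ _ _) delay_count // /sstep /sc_action /= (negbTE zE.2.1).
  exists (sim_init M); split; rewrite /= ?addn0 ?addn1 ?subn0 //.
  by rewrite if_same.
rewrite addSn /srun iterS -/(srun _ _ _).
case: (srun delay z _) => m' p s o e [m [/= -> -> [S Ec] -> ->]].
rewrite /sstep /sc_action /= zE.2.2 (sim_actionE _ S).
exists (sim_next prj_symbol (cfg_action w (xrun M w t).1) (fun j => ohead (s (inl j)))).
rewrite Ec; split; rewrite //= ?addnA ?cats0 //.
- split; first exact: (simulates_step inj_symbolK w S).
  by rewrite Ec subnS; case: (n - t).
- case: (leqP n t) => le.
    have /negbTE := quiet le.
    rewrite (eqP (_ : n - t == 0)) ?subn_eq0 //= (leqW le).
    by case: (act_output _).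
  rewrite (_ : n - t = (n - t).-1.+1) /=; last by rewrite prednK // subn_gt0.
  by case: (leqP n t.+1) => // le'; rewrite -start_empty (_ : n = t.+1) // ; apply/eqP;
    rewrite eqn_leq le'.
- by case: (nseq _ _) => //=; case: (act_output _).
Qed.

Lemma delay_swrites u : writes M w u -> swrites delay z u.
Proof.
move=> [e H]; exists 0 => k; have [t [_ P]] := H (maxn k n).
have nt : n <= t.
  by have := leq_trans (size_prefix P) (size_output_le _ _ _);
     rewrite size_mkseq; apply: leq_trans; exact: leq_maxr.
have [m [_ _ _ Eo Ee]] := delay_run t; exists (t + n.+1); rewrite Ee Eo nt; split=> //.
by apply: prefix_trans P; apply: mkseq_prefix; exact: leq_maxl.
Qed.
End Delay.

(** Each round makes one step of M and writes one block.  In round t, clock counts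
    t.+1 after the step, so that writing one letter before printing clock or cand
    gives t.+2 or the candidate plus one, that is, the code that excludes t.+1 or
    the candidate.  After an erasure clock is copied to cand while being
    restored. *)
Local Notation clock := (inr L0).
Local Notation copy := (inr L1).
Local Notation cand := (inr L2).
Local Notation simulating := L0.
Local Notation closing := L1.
Local Notation rewinding := L2.

Definition refute_mem : finType := (label * bool * sim_mem M)%type.

Definition refute_trans (q : refute_mem) (b : bool) (top : one_index -> option one_letter) :
    saction refute_mem one_letter one_index :=
  let: (ph, er, m) := q in
  match ph with
  | simulating =>
    let a := sim_action m b in let er' := erasing (act_output a) in
    SAction ((closing, er', sim_next prj_symbol a (fun j => top (inl j))) : refute_mem)
      (act_advance a)
      (fun i => match i with
         | inl j => sim_ops inj_symbol a j | clock => Push mark | _ => Keep end)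
      (OutWrite true)
      (Some (if er' then (cand, finset.set0, true) else (clock, [set copy], true)))
  | closing => SAction ((rewinding, er, m) : refute_mem) false (fun=> Keep) (OutWrite false)
            (if er then Some (clock, [set copy; cand], false) else None)
  | _ => SAction ((simulating, er, m) : refute_mem) false (fun=> Keep) OutNone
            (Some (copy, [set clock], false))
  end.

Definition refuter : smachine :=
  SMachine ((simulating, false, sim_init M) : refute_mem) refute_trans.

Lemma refuter_never_erases : snever_erases refuter.
Proof. by case=> [[[] er] m] b top. Qed.

Section Refuter.
Variable w : word.

Definition erases (t : nat) : bool :=
  erasing (act_output (cfg_action w (xrun M w t).1)).

Fixpoint candidate (t : nat) : nat :=
  if t is t'.+1 then if erases t' then t else candidate t' else 0.

Definition refuted : baire := fun t => if erases t then (candidate t).+1 else t.+2.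

Definition refuter_at (t : nat) (c : sconfig refuter) : Prop :=
  exists er m, [/\ sc_mem c = (simulating, er, m), sc_input c = cfg_input (xrun M w t).1,
    simulates inj_symbol m (fun j => sc_stack c (inl j)) (xrun M w t).1 /\
    [/\ sc_stack c clock = nseq t mark, sc_stack c copy = [::] &
        sc_stack c cand = nseq (candidate t) mark],
    sc_output c = unary_prefix refuted t & sc_erasures c = 0].

Lemma refuter_run t : refuter_at t (srun refuter w (3 * t)).
Proof.
elim: t => [|t]; first by exists false, (sim_init M).
rewrite mulnS srun_iter.
case: (srun refuter w _) => m' p s o e [er [m [/= -> -> [S [Et Ec Ed]] -> ->]]].
rewrite /sstep /sc_action /= (sim_actionE _ S) -/(erases t).
set a := cfg_action w (xrun M w t).1 in S *.
exists (erases t), (sim_next prj_symbol a (fun j => ohead (s (inl j)))).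
rewrite unary_prefixS /refuted.
have S' := simulates_step inj_symbolK w S; rewrite -/a in S'.
case ert : (erases t); split; rewrite /= ?ert ?addn0 ?cats0 //.
- split; first by apply: (simulates_ext S') => j; rewrite !indexE.
  rewrite !indexE /= ?Et ?Ec ?Ed; split=> //;
    by rewrite ?catrevE ?cats0 ?rev_cat ?rev_nseq ?cats1 -?nseq_rcons.
- by rewrite Ed size_nseq cat_rcons rcons_cat.
- split; first by apply: (simulates_ext S') => j; rewrite !indexE.
  rewrite !indexE /= ?Et ?Ec ?Ed; split=> //;
    by rewrite ?catrevE ?cats0 ?rev_cat ?rev_nseq ?cats1 -?nseq_rcons.
- by rewrite Et size_nseq cat_rcons rcons_cat.
Qed.

Lemma refuter_swrites : swrites refuter w (unary refuted).
Proof.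
exists 0 => k; have [er [m [_ _ _ Eo Ee]]] := refuter_run k.
exists (3 * k); rewrite Ee Eo; split=> //; rewrite unary_prefixE.
by apply: mkseq_prefix; exact: size_unary_prefix.
Qed.

(** The candidate at t is 0 or the successor of an instant of erasure before t. *)
Lemma candidate_le t : candidate t <= t.
Proof. by elim: t => //= t IH; case: ifP => // _; exact: leqW. Qed.

Lemma candidate_le_mono s t : s <= t -> candidate s <= candidate t.
Proof.
move/subnK <-; elim: (t - s) => // n IH; rewrite addSn /=; case: ifP => // _.
by apply: leq_trans IH _; apply: leqW; exact: candidate_le.
Qed.

Lemma candidate_steady s t : s <= t -> (forall i, s <= i < t -> ~~ erases i) ->
  candidate t = candidate s.
Proof.
move/subnK <-; elim: (t - s) => // n IH H; rewrite addSn /=.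
rewrite (negbTE (H (n + s) _)) ?leq_addl ?addSn ?leqnn //.
by apply: IH => i /andP [le lt]; apply: H; rewrite le addSn ltnW.
Qed.

(** If m.+1 is not refuted in round m then M erases at m.  If M erased again at or
    after n, the first such erasure would find n as the candidate and refute
    it. *)
Lemma not_refuted n : (forall t, refuted t <> n.+1) ->
  (n = 0 \/ exists2 m, n = m.+1 & erases m) /\ forall t, n <= t -> ~~ erases t.
Proof.
move=> H.
have E : n = 0 \/ exists2 m, n = m.+1 & erases m.
  case: n H => [|m] H; [by left | right; exists m => //].
  by apply: contraT => /negbTE nE; have := H m; rewrite /refuted nE.
split=> // t le; apply/negP => er.
have exP : exists t, (n <= t) && erases t by exists t; rewrite le er.
have [t0 /andP [le0 er0] least] := ex_minnP exP.
have cn : candidate n = n by case: E => [->|[m -> /= ->]].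
apply: (H t0); rewrite /refuted er0 (candidate_steady le0) ?cn //.
move=> i /andP [lei lt]; apply/negP => eri.
by have := least i; rewrite lei eri => /(_ isT); rewrite leqNgt lt.
Qed.

(** Candidates are refuted when they are replaced by larger ones, and an instant that
    follows an erasure is not refuted in the round of that erasure. *)
Lemma last_candidate_not_refuted t0 : (forall t, t0 <= t -> ~~ erases t) ->
  forall t, refuted t <> (candidate t0).+1.
Proof.
move=> noer t; rewrite /refuted; case er : (erases t) => - [E].
  have lt : t < t0 by rewrite ltnNge; apply/negP => /noer; rewrite er.
  have := candidate_le_mono lt; rewrite /= er -E.
  by rewrite ltnNge candidate_le.
have lt : t < t0 by rewrite E; exact: candidate_le.
have H s : candidate s = t.+1 -> erases t.
  elim: s => //= s IH; case: ifP => [ers [<-] //|_]; exact: IH.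
by have := H _ (esym E); rewrite er.
Qed.
End Refuter.
End OneMachine.

(** * The three reductions *)

Definition compose (alt : bool) (M1 M2 : machine) : machine :=
  compile (composite alt M1 M2).

Lemma compose_writes M1 M2 w u v :
  writes M1 w u -> writes M2 u v -> writes (compose false M1 M2) w v.
Proof.
move=> W1 W2; apply: compile_writes; apply: (comp_swrites W1).
by rewrite mix_noalt.
Qed.

Lemma compose_pair_writes M1 M2 p q v :
  writes M1 (unary p) (unary q) -> writes M2 (unary (bpair p q)) v ->
  writes (compose true M1 M2) (unary p) v.
Proof.
move=> W1 W2; apply: compile_writes; apply: (comp_swrites W1).
by rewrite mix_unary.
Qed.

Lemma compose_never_erases alt M1 M2 :
  never_erases M1 -> never_erases M2 -> never_erases (compose alt M1 M2).
Proof. by move=> nv1 nv2; apply: compile_never_erases; exact: comp_never_erases. Qed.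

Lemma to_nat_ge i j : i <= Cantor.to_nat (i, j).
Proof. by have := Cantor.to_nat_non_decreasing i j; lia. Qed.

Lemma lim_discrete_const (z : baire) n s0 : (forall s, s0 <= s -> z s = n) ->
  lim_discrete z (fun=> n).
Proof.
move=> Hz; exists (fun i j => z (Cantor.to_nat (i, j))); split.
  apply/funext => k; rewrite /btuple; have := Cantor.cancel_to_of k.
  by case: (Cantor.of_nat k) => i j ->.
exists s0 => i le; apply/funext => j; apply: Hz; apply: leq_trans le _.
exact: to_nat_ge.
Qed.

Lemma lim_discrete_eventually (z q : baire) n s0 : (forall s, s0 <= s -> z s = n) ->
  lim_discrete z q -> q 0 = n.
Proof.
move=> Hz [ps [zE [n0 Hps]]]; rewrite -(Hps (maxn n0 s0)) ?leq_maxl //.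
rewrite -(Hz (Cantor.to_nat (maxn n0 s0, 0))).
  by rewrite zE /btuple Cantor.cancel_of_to.
by apply: leq_trans (to_nat_ge _ _); exact: leq_maxr.
Qed.

Lemma least_seq_choice h a : ~ (exists k, h k = a.+1) ->
  exists n s0, ~ (exists k, h k = n.+1) /\ forall s, s0 <= s -> least_seq h s = n.
Proof.
move=> Aa; pose P n := `[< ~ exists k, h k = n.+1 >].
have exP : exists n, P n by exists a; apply/asboolP.
have [n /asboolP Pn least] := ex_minnP exP; exists n.
have [||s0 Hs0] := @least_seq_limit h n.
- by move=> k E; apply: Pn; exists k.
- move=> m lt; apply: contrapT => nm; have := least m; rewrite leqNgt lt => H.
  by have := H (asboolT nm).
by exists s0.
Qed.

(** A realizer that is undefined outside the domain of g.  Such a realizer forces H to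
    produce names of points of that domain, which a realizer with arbitrary values
    elsewhere would not. *)
Lemma realizer_exists (Z W : represented) (g : mvfun Z W) :
  exists2 G, realizes G g & forall h r, G h = Some r ->
    exists x y, [/\ rep Z h = Some x, rep W r = Some y & g x y].
Proof.
pose ok h r := exists x y, [/\ rep Z h = Some x, rep W r = Some y & g x y].
exists (fun h =>
  if pselect (exists r, ok h r) is left e then Some (sval (cid e)) else None).
  move=> h x hx [y gxy]; case: pselect => [e|]; last first.
    by case; have [r Er] := rep_surj y; exists r, x, y.
  have [x' [y' [E1 E2 E3]]] := svalP (cid e); exists (sval (cid e)), y'; split=> //.
  by move: E1; rewrite hx => - [->].
by move=> h r; case: pselect => // e [<-]; exact: svalP (cid e).
Qed.

(** Given a realizer G of the discrete limit, the value of G at the sequence of least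
    numbers is also the value at h of some realizer of closed choice, so that K
    accepts it. *)
Lemma choice_to_lim (X Y : represented) (f : mvfun X Y) :
  weihrauch_le f choice_nat -> weihrauch_le f lim_discrete.
Proof.
move=> [K [H [cK cH KH]]]; exists K, (omap least_seq \o H); split=> //.
  have /computableP [MH nv W] := cH; apply/computableP.
  exists (compose false MH (compile least)).
    apply: compose_never_erases => //; apply: compile_never_erases.
    exact: least_never_erases.
  move=> p q /=; case E : (H p) => [h|] //= [<-]; apply: (compose_writes (W _ _ E)).
  by apply: compile_writes; exact: least_swrites.
move=> G GR p x px dx.
have [G0 G0R G0P] := @realizer_exists closed_space nat_space choice_nat.
have [q0 [y0 [E0 _ _]]] := KH G0 G0R p x px dx.
move: E0; case E : (H p) => [h|] //=; case Eh : (G0 h) => [r0|] //= _.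
have [A [a [hA ra Aa]]] := G0P _ _ Eh.
have AE : A = (fun n => ~ exists k, h k = n.+1) by case: hA.
rewrite AE in Aa; have [n [s0 [Pn Hn]]] := least_seq_choice Aa.
have [r [s [Gr rs Lr]]] := GR (least_seq h) _ erefl
  (ex_intro _ _ (lim_discrete_const Hn)).
move: rs Lr => [<-] {s} Lr.
have r0n := lim_discrete_eventually Hn Lr.
(* G0 changed at h: there r is an admissible answer too. *)
have G1R : @realizes closed_space nat_space
    (fun h' => if pselect (h' = h) then Some r else G0 h') choice_nat.
  move=> h' A' hA' dA'; case: pselect => [h'E|ne]; last exact: G0R.
  exists r, (r 0); split=> //.
  by rewrite r0n; case: hA' => <-; rewrite h'E.
have := KH _ G1R p x px dx; rewrite E /=; case: pselect => // hh /=.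
by rewrite Gr.
Qed.

Lemma lim_to_mind_change (X Y : represented) (f : mvfun X Y) :
  weihrauch_le f lim_discrete -> mind_change_computable f.
Proof.
move=> [K [H [/computableP [MK nvK WK] /computableP [MH nvH WH] KH]]].
exists (compose true (compose false MH (compile limit)) MK) => p x px dx.
have [G GR GP] := @realizer_exists baire_space baire_space lim_discrete.
have [r [y [E ry fxy]]] := KH G GR p x px dx.
exists r, y; split=> //; apply/finally_writesP.
move: E; case EH : (H p) => [h|] //=; case EG : (G h) => [q|] //= EK.
have [h' [q' [[<-] [<-] [ps [hE [n0 Hps]]]]]] := GP _ _ EG.
apply: (compose_pair_writes _ (WK _ _ EK)).
apply: (compose_writes (WH _ _ EH)); rewrite hE.
by apply: compile_writes; exact: (limit_swrites Hps).
Qed.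

Lemma unary_prefix_cons n p k :
  unary_prefix (consb n p) k.+1 = unary_block n ++ unary_prefix p k.
Proof.
by elim: k => [|k IH]; rewrite unary_prefixS ?IH -?catA ?cats0 // -unary_prefixS.
Qed.

Lemma unary_cons n p :
  (forall i, i < n -> unary (consb n p) i) /\ ~~ unary (consb n p) n /\
  forall i, unary (consb n p) (n.+1 + i) = unary p i.
Proof.
have L o : o <= n -> unary (consb n p) o = (o < n).
  exact: (@unary_letter (consb n p) 0 o).
split; first by move=> i lt; rewrite (L _ (ltnW lt)).
split; first by rewrite (L _ (leqnn n)) ltnn.
move=> i; rewrite -(@nth_unary_prefix _ i.+2); last first.
  rewrite unary_prefix_cons size_cat size_rcons size_nseq ltn_add2l.
  exact: size_unary_prefix.
rewrite unary_prefix_cons nth_cat size_rcons size_nseq ltnNge leq_addr /=.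
by rewrite addKn nth_unary_prefix // size_unary_prefix.
Qed.

Definition left_half (x : baire) : baire := fun n => x n.*2.

Lemma left_half_pair p r : left_half (bpair p r) = p.
Proof. by apply/funext => n; rewrite /left_half /bpair odd_double doubleK. Qed.

Lemma bpair_halves x : x = bpair (left_half x) (fun n => x n.*2.+1).
Proof.
apply/funext => n; rewrite /bpair /left_half.
by case: ifP (odd_double_half n) => [_|_] {1}<-.
Qed.

(** The condition on n under which the output of M after n steps, as written by
    [delay], is the output of M. *)
Definition settled_from (M : machine) (w : word) (n : nat) : Prop :=
  (forall t, n <= t -> ~~ erases M w t) /\ cfg_output (xrun M w n).1 = [::].

Lemma not_refuted_settled M w n : (forall t, refuted M w t <> n.+1) -> settled_from M w n.
Proof.
move=> /not_refuted [E Q]; split=> //; case: E => [->|[m -> em]] //.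
by move: em; rewrite xrunS /= /erases; case: (act_output _).
Qed.

(** K is partial: it is defined only where some q is both written by M and a name of
    an admissible value, so that its machine need not be correct elsewhere. *)
Lemma mind_change_to_choice (X Y : represented) (f : mvfun X Y) :
  mind_change_computable f -> weihrauch_le f choice_nat.
Proof.
move=> [M HM].
pose good z q := [/\ settled_from M (unary (left_half z)) (z 1),
  writes M (unary (left_half z)) (unary q) &
  exists x y, [/\ rep X (left_half z) = Some x, rep Y q = Some y & f x y]].
pose K z := if pselect (exists q, good z q) is left e then Some (sval (cid e)) else None.
exists K, (fun p => Some (refuted M (unary p))); split.
- apply/computableP; exists (compose false (compile split_machine) (compile (delay M))).
    apply: compose_never_erases; apply: compile_never_erases.
      exact: split_never_erases.
    exact: delay_never_erases.
  move=> z q; rewrite /K; case: pselect => // e [<-].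
  have [[quiet empty] W _] := svalP (cid e).
  apply: (@compose_writes _ _ _ (unary (consb (z 1) (left_half z)))).
    by apply: compile_writes; rewrite {1}[z]bpair_halves; exact: split_swrites.
  apply: compile_writes; exact: (delay_swrites (unary_cons _ _) quiet empty W).
- apply/computableP; exists (compile (refuter M)).
    by apply: compile_never_erases; exact: refuter_never_erases.
  by move=> p q [<-]; apply: compile_writes; exact: refuter_swrites.
move=> G GR p x px dx; have [q [y [/finally_writesP W qy fxy]]] := HM p x px dx.
set h := refuted M (unary p).
have [t0 [noer _ _]] := writes_stable W.
have [//||r [n [Gh [rn] An]]] := GR h [set n | ~ exists k, h k = n.+1]%classic.
  exists (candidate M (unary p) t0) => - [k].
  by apply: last_candidate_not_refuted.
have exq : exists q, good (bpair p r) q.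
  exists q; rewrite /good left_half_pair; split=> //; last by exists x, y.
  rewrite /bpair /= rn; apply: not_refuted_settled => t E; apply: An; by exists t.
rewrite /= Gh /= /K; case: pselect => // e; exists (sval (cid e)).
have [_ _ [x' [y' [px' qy' fxy']]]] := svalP (cid e).
exists y'; split=> //; move: px'; rewrite left_half_pair px => - [->].
by [].
Qed.

Theorem theorem7p11 (X Y : represented) (f : mvfun X Y) :
  (weihrauch_le f choice_nat <-> weihrauch_le f lim_discrete) /\
  (weihrauch_le f lim_discrete <-> mind_change_computable f).
Proof.
have H12 := @choice_to_lim X Y f.
have H23 := @lim_to_mind_change X Y f.
have H31 := @mind_change_to_choice X Y f.
by split; split=> // H; [apply/H31/H23 | apply/H12/H31].
Qed.
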